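(* Let $\mathcal{K}$ be an $\infty$-cosmos, let $f\colon A\to B$ be a functor in $\mathcal{K}$, and let $t\colon A\to B\downarrow f$ be the functor over $A\times B$ induced by the identity 2-cell of $f$, i.e. with $p_1t=\mathrm{id}_A$, $p_0t=f$, and $\phi t=\mathrm{id}_f$. Then for any module $E$ from $A$ to $B$, precomposition with $t$ induces an equivalence of quasi-categories $$\mathrm{map}_{A\times B}(B\downarrow f,E)\simeq\mathrm{map}_{A\times B}(A,E),$$ where $A$ is regarded as lying over $A\times B$ via $(\mathrm{id}_A,f)\colon A\to A\times B$.
   Context: An $\infty$-cosmos (with all objects cofibrant) is a simplicially enriched category $\mathcal{K}$ whose mapping spaces $\mathrm{map}(A,B)$ are quasi-categories, equipped with a subcategory of isofibrations (written $\twoheadrightarrow$), such that: (a) $\mathcal{K}$ has, in the simplicially enriched sense, a terminal object $1$, cotensors $U\pitchfork A$ of every object $A$ by every finitely presented simplicial set $U$, and pullbacks of isofibrations along arbitrary morphisms (''simplicial pullbacks''); (b) isofibrations include all isomorphisms and all maps $A\to 1$, are stable under pullback, for every isofibration $p\colon E\twoheadrightarrow B$ and inclusion $U\hookrightarrow V$ of finitely presented simplicial sets the induced map $V\pitchfork E\to (U\pitchfork E)\times_{U\pitchfork B}(V\pitchfork B)$ is an isofibration, and $\mathrm{map}(X,p)$ is an isofibration of quasi-categories for every object $X$; (c) every object has the left lifting property with respect to trivial fibrations. Here $f$ is an equivalence if $\mathrm{map}(X,f)$ is an equivalence of quasi-categories for all $X$, and a trivial fibration if it is an isofibration and an equivalence.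 Objects of $\mathcal{K}$ are called $\infty$-categories and its morphisms functors. The homotopy 2-category $\mathcal{K}_2$ has the same objects and 1-cells, with $\hom(A,B)$ the homotopy category of $\mathrm{map}(A,B)$. For an object $B$, the sliced $\infty$-cosmos $\mathcal{K}/B$ has as objects the isofibrations with codomain $B$, and as mapping quasi-category $\mathrm{map}_B(E,F)$ from $p\colon E\to B$ to $q\colon F\twoheadrightarrow B$ the fibre of $\mathrm{map}(E,q)\colon\mathrm{map}(E,F)\to\mathrm{map}(E,B)$ over $p$ (the same notation is used when $p$ is an arbitrary functor, not necessarily an isofibration); its isofibrations and equivalences are created by the forgetful functor to $\mathcal{K}$. Its homotopy 2-category is $(\mathcal{K}/B)_2$. For a functor $f\colon A\to B$, the comma $\infty$-category $B\downarrow f$ is the simplicial pullback of $(p_1,p_0)\colon\Delta^1\pitchfork B\twoheadrightarrow B\times B$ (evaluation at $1$ and $0$) along $f\times\mathrm{id}_B\colon A\times B\to B\times B$; it carries an isofibration $(p_1,p_0)\colon B\downarrow f\twoheadrightarrow A\times B$ and a canonical 2-cell $\phi\colon p_0\Rightarrow fp_1$ in $\mathcal{K}_2$. Functors $X\to B\downarrow f$ over $A\times B$ are induced, uniquely up to isomorphism over $A\times B$, by 2-cells $b\Rightarrow fc$ with $c\colon X\to A$, $b\colon X\to B$. A 2-cell $\chi\colon e'\Rightarrow e\colon X\to E$ in a homotopy 2-category is $p$-cartesian for an isofibration $p\colon E\twoheadrightarrow B$ if (i) for all $\tau\colon e''\Rightarrow e$ and $\gamma\colon pe''\Rightarrow pe'$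 with $p\tau=p\chi\cdot\gamma$ there is $\bar\gamma\colon e''\Rightarrow e'$ with $p\bar\gamma=\gamma$ and $\tau=\chi\cdot\bar\gamma$; and (ii) any $\gamma\colon e'\Rightarrow e'$ with $\chi\cdot\gamma=\chi$ and $p\gamma$ an identity is an isomorphism. The isofibration $p$ is a cartesian fibration if every 2-cell $\alpha\colon b\Rightarrow pe$ has a $p$-cartesian lift $\chi\colon e'\Rightarrow e$ with $p\chi=\alpha$, and $p$-cartesian 2-cells are closed under precomposition by functors. Cocartesian fibrations are defined dually, reversing 2-cells. An object is groupoidal if every 2-cell with that object as codomain in the homotopy 2-category is invertible. A module from $A$ to $B$ is an isofibration $(q,p)\colon E\twoheadrightarrow A\times B$ that (i) is a cartesian fibration in $(\mathcal{K}/A)_2$ (as a map from $q$ to the projection $A\times B\to A$), (ii) is a cocartesian fibration in $(\mathcal{K}/B)_2$ (as a map from $p$ to the projection $A\times B\to B$), and (iii) is groupoidal as an object of $\mathcal{K}/(A\times B)$. *)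

(* Defs.v *)
From Stdlib Require List.
From mathcomp Require Import all_boot boolp.

Set Implicit Arguments.
Unset Strict Implicit.
Unset Printing Implicit Defensive.

Declare Scope cosmos_scope.
Delimit Scope cosmos_scope with cosmos.
Local Open Scope cosmos_scope.

(** * Simplicial sets *)

(* Morphisms [m] -> [n] of the simplex category. *)
Record dmap (m n : nat) := DMap {
  dfun :> {ffun 'I_m.+1 -> 'I_n.+1};
  dfunP : [forall i : 'I_m.+1, forall j : 'I_m.+1, (i <= j) ==> (dfun i <= dfun j)] }.

Lemma dmapP m n (a b : dmap m n) : (forall i, a i = b i) -> a = b.
Proof.
case: a b => [a pa] [b pb] /= E; have {}E : a = b by apply/ffunP.
by case: _ / E in pb *; rewrite (bool_irrelevance pa pb).
Qed.

Lemma dmap_mono m n (a : dmap m n) (i j : 'I_m.+1) : i <= j -> a i <= a j.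
Proof. by case: a => a /= /forallP/(_ i)/forallP/(_ j)/implyP. Qed.

Lemma dmap_of_subproof m n (f : 'I_m.+1 -> 'I_n.+1) :
  (forall i j : 'I_m.+1, i <= j -> f i <= f j) ->
  [forall i : 'I_m.+1, forall j : 'I_m.+1,
    (i <= j) ==> ([ffun i => f i] i <= [ffun i => f i] j)].
Proof.
move=> fP; apply/forallP => i; apply/forallP => j; apply/implyP.
by rewrite !ffunE; apply: fP.
Qed.

Definition dmap_of m n (f : 'I_m.+1 -> 'I_n.+1)
    (fP : forall i j : 'I_m.+1, i <= j -> f i <= f j) : dmap m n :=
  DMap (dmap_of_subproof fP).

Definition did n : dmap n n := dmap_of (f := id) (fun _ _ h => h).

Definition dcomp l m n (a : dmap m n) (b : dmap l m) : dmap l n :=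
  dmap_of (f := fun i => a (b i)) (fun _ _ h => dmap_mono a (dmap_mono b h)).

Definition dconst m n (k : 'I_n.+1) : dmap m n :=
  dmap_of (f := fun=> k) (fun _ _ _ => leqnn k).

(* The coface [n] -> [n+1] omitting the value k. *)
Definition dface n (k : 'I_n.+2) : dmap n n.+1.
Proof. by refine (dmap_of (f := lift k) _) => i j; rewrite /= leq_bump2. Defined.

Record sSet := SSet {
  simplex :> nat -> Type;
  act : forall m n, dmap m n -> simplex n -> simplex m;
  act_id : forall n (x : simplex n), act (did n) x = x;
  act_comp : forall l m n (a : dmap m n) (b : dmap l m) (x : simplex n),
    act b (act a x) = act (dcomp a b) x }.

Record smap (X Y : sSet) := SMap {
  sfun :> forall n, X n -> Y n;
  sfunP : forall m n (a : dmap m n) (x : X n),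
    sfun (act a x) = act a (sfun x) }.

Definition scomp X Y Z (g : smap Y Z) (f : smap X Y) : smap X Z.
Proof. by exists (fun n x => g n (f n x)) => m n a x; rewrite !sfunP. Defined.

Definition sprod (X Y : sSet) : sSet.
Proof.
exists (fun n => (X n * Y n)%type) (fun m n a x => (act a x.1, act a x.2)).
- by move=> n [x y] /=; rewrite !act_id.
- by move=> l m n a b [x y] /=; rewrite !act_comp.
Defined.

Definition sfst X Y : smap (sprod X Y) X.
Proof. by exists (fun n x => x.1). Defined.

Definition Delta (n : nat) : sSet.
Proof.
exists (fun m => dmap m n) (fun l m b a => dcomp a b).
- by move=> m a; apply: dmapP => i; rewrite !ffunE.
- by move=> k l m b c a; apply: dmapP => i; rewrite !ffunE.
Defined.

(* The horn omitting the face opposite to the vertex k. *)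
Definition in_horn n (k : 'I_n.+1) m (a : dmap m n) : bool :=
  [exists j, (j != k) && [forall i, a i != j]].

Lemma in_horn_comp n (k : 'I_n.+1) l m (a : dmap m n) (b : dmap l m) :
  in_horn k a -> in_horn k (dcomp a b).
Proof.
case/existsP=> j /andP[jk /forallP aj]; apply/existsP; exists j.
by rewrite jk; apply/forallP => i; rewrite ffunE.
Qed.

Definition horn n (k : 'I_n.+1) : sSet.
Proof.
exists (fun m => {a : dmap m n | in_horn k a})
  (fun l m b a => exist _ (dcomp (sval a) b) (in_horn_comp b (svalP a))).
- by move=> m [a h]; apply: eq_exist; apply: dmapP => i; rewrite !ffunE.
- by move=> i l m b c [a h]; apply: eq_exist; apply: dmapP => j; rewrite !ffunE.
Defined.

Definition horn_incl n (k : 'I_n.+1) : smap (horn k) (Delta n).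
Proof. by exists (fun m a => sval a). Defined.

(* The nerve of the free-living isomorphism; between any two of its two objects
   there is exactly one arrow, so an n-simplex is a sequence of n+1 objects. *)
Definition J : sSet.
Proof.
exists (fun n => {ffun 'I_n.+1 -> bool}) (fun m n a x => [ffun i => x (a i)]).
- by move=> n x; apply/ffunP => i; rewrite !ffunE.
- by move=> l m n a b x; apply/ffunP => i; rewrite !ffunE.
Defined.

Definition J_vertex (e : bool) n : J n := [ffun=> e].

Definition J_incl : smap (Delta 0) J.
Proof.
by exists (fun n _ => J_vertex false n) => m n a x; apply/ffunP => i; rewrite !ffunE.
Defined.

Definition degenerate (X : sSet) n (x : X n) : Prop :=
  exists m (a : dmap n m) (y : X m), m < n /\ x = act a y.

(* A simplicial set is finitely presented when its nondegenerate simplices, over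
   all dimensions together, can be listed. *)
Definition fin_presented (X : sSet) : Prop :=
  exists s : list {n : nat & X n},
    forall n (x : X n), ~ degenerate x -> List.In (existT _ n x) s.

Definition smono (U V : sSet) (i : smap U V) : Prop :=
  forall n, injective (i n).

(** * Quasi-categories *)

Definition rlp (U V X Y : sSet) (i : smap U V) (p : smap X Y) : Prop :=
  forall (u : smap U X) (v : smap V Y),
    (forall n x, p n (u n x) = v n (i n x)) ->
    exists l : smap V X,
      (forall n x, l n (i n x) = u n x) /\ (forall n x, p n (l n x) = v n x).

Definition is_quasicat (X : sSet) : Prop :=
  forall n (k : 'I_n.+1), 0 < k < n -> forall u : smap (horn k) X,
    exists l : smap (Delta n) X, forall m x, l m (horn_incl k m x) = u m x.

Record qCat := QCat { qcat_sset :> sSet; qcatP : is_quasicat qcat_sset }.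

Definition qcat_isofib (X Y : qCat) (p : smap X Y) : Prop :=
  (forall n (k : 'I_n.+1), 0 < k < n -> rlp (horn_incl k) p) /\ rlp J_incl p.

(* Since J is symmetric, the direction of the two homotopies is immaterial. *)
Definition qcat_equiv (X Y : qCat) (f : smap X Y) : Prop :=
  exists (g : smap Y X) (a : smap (sprod X J) X) (b : smap (sprod Y J) Y),
    [/\ forall n x, a n (x, J_vertex false n) = x,
        forall n x, a n (x, J_vertex true n) = g n (f n x),
        forall n y, b n (y, J_vertex false n) = f n (g n y) &
        forall n y, b n (y, J_vertex true n) = y].

(** ** The homotopy category of a quasi-category

    Its arrows x -> y are represented by the 1-simplices from x to y; two of them
    are the same arrow when they are related by [htpy], and [htri f g h] says that
    h represents the composite of f followed by g. *)

Definition face (X : sSet) n (k : 'I_n.+2) (x : X n.+1) : X n := act (dface k) x.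

Definition const (X : sSet) n (x : X 0) : X n := act (dconst n ord0) x.

Definition src (X : sSet) (e : X 1) : X 0 := face ord_max e.
Definition tgt (X : sSet) (e : X 1) : X 0 := face ord0 e.

Definition arr (X : sSet) (x y : X 0) (e : X 1) : Prop := src e = x /\ tgt e = y.

Definition htri (X : sSet) (f g h : X 1) : Prop :=
  exists s : X 2, [/\ face ord_max s = f, face ord0 s = g & face (inord 1) s = h].

Definition htpy (X : sSet) (e e' : X 1) : Prop := htri e (const 1 (tgt e)) e'.

Definition hiso (X : sSet) (e : X 1) : Prop :=
  exists e' : X 1, [/\ arr (tgt e) (src e) e',
    htri e e' (const 1 (src e)) & htri e' e (const 1 (tgt e))].

(** * Quasi-categorically enriched categories with a class of isofibrations *)

Record isoCat := IsoCat {
  obj :> Type;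
  hom : obj -> obj -> qCat;
  idf : forall A, hom A A 0;
  kcomp : forall A B C n, hom B C n -> hom A B n -> hom A C n;
  isofib : forall A B, hom A B 0 -> Prop;
  kcomp_act : forall A B C m n (a : dmap m n) (g : hom B C n) (f : hom A B n),
    kcomp (act a g) (act a f) = act a (kcomp g f);
  kcomp_assoc : forall A B C D n (h : hom C D n) (g : hom B C n) (f : hom A B n),
    kcomp h (kcomp g f) = kcomp (kcomp h g) f;
  kcomp_idl : forall A B n (f : hom A B n), kcomp (const n (idf B)) f = f;
  kcomp_idr : forall A B n (f : hom A B n), kcomp f (const n (idf A)) = f }.

Arguments idf {K} A : rename.
Arguments hom {K} A B : rename.

Notation "A ~> B" := (simplex (qcat_sset (hom A B)) 0)
  (at level 90, B at level 89, no associativity) : cosmos_scope.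

Section Whiskering.
Variable K : isoCat.
Implicit Types A B C X : K.

Definition post X A B (f : A ~> B) n (x : hom X A n) : hom X B n :=
  kcomp (const n f) x.

Definition pre X Y A (g : X ~> Y) n (y : hom Y A n) : hom X A n :=
  kcomp y (const n g).

Lemma act_const (S : sSet) m n (a : dmap m n) (x : S 0) :
  act a (const n x) = const m x.
Proof. by rewrite /const act_comp; congr act; apply: dmapP => i; rewrite !ffunE. Qed.

Lemma const0 (S : sSet) (x : S 0) : const 0 x = x.
Proof.
rewrite -[RHS]act_id /const; congr act.
by apply: dmapP => i; rewrite !ffunE ord1.
Qed.

Lemma const_comp A B C n (g : B ~> C) (f : A ~> B) :
  const n (kcomp g f) = kcomp (const n g) (const n f).
Proof. by rewrite /const kcomp_act. Qed.

Definition post_map X A B (f : A ~> B) : smap (hom X A) (hom X B).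
Proof.
by exists (fun n x => post f x) => m n a x; rewrite /post -kcomp_act act_const.
Defined.

Definition is_iso A B (f : A ~> B) : Prop :=
  exists g : B ~> A, kcomp g f = idf A /\ kcomp f g = idf B.

Definition is_equiv A B (f : A ~> B) : Prop :=
  forall X, qcat_equiv (post_map X f).

Definition trivial_fib A B (f : A ~> B) : Prop := isofib f /\ is_equiv f.

(** ** Simplicially enriched limits *)

Record terminal := Terminal {
  one : K;
  bang : forall X n, hom X one n;
  bang_uniq : forall X n (x y : hom X one n), x = y }.

Record pullback A E B (f : A ~> B) (p : E ~> B) := Pullback {
  pb :> K;
  pb1 : pb ~> A;
  pb2 : pb ~> E;
  pb_sq : kcomp f pb1 = kcomp p pb2;
  pb_ind : forall X n (a : hom X A n) (e : hom X E n),
    post f a = post p e -> hom X pb n;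
  pb_ind1 : forall X n a e (h : post f a = post p e :> hom X B n),
    post pb1 (pb_ind h) = a;
  pb_ind2 : forall X n a e (h : post f a = post p e :> hom X B n),
    post pb2 (pb_ind h) = e;
  pb_uniq : forall X n (x y : hom X pb n),
    post pb1 x = post pb1 y -> post pb2 x = post pb2 y -> x = y }.

(* The weight U is sent to A by [ct_cone]; n-simplices of the exponential
   hom X A ^ U are the simplicial maps U * Delta n -> hom X A. *)
Record cotensor (U : sSet) A := Cotensor {
  ct :> K;
  ct_cone : smap U (hom ct A);
  ct_ind : forall X n, smap (sprod U (Delta n)) (hom X A) -> hom X ct n;
  ct_indE : forall X n (g : smap (sprod U (Delta n)) (hom X A)) k
      (u : U k) (a : Delta n k),
    kcomp (ct_cone k u) (act a (ct_ind g)) = g k (u, a);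
  ct_uniq : forall X n (x y : hom X ct n),
    (forall k (u : U k) (a : Delta n k),
      kcomp (ct_cone k u) (act a x) = kcomp (ct_cone k u) (act a y)) -> x = y }.

Definition ct_arr U A (T : cotensor U A) X (g : smap U (hom X A)) : X ~> T :=
  ct_ind T (scomp g (sfst U (Delta 0))).

Definition ct_restr U V (i : smap U V) A (TV : cotensor V A) (TU : cotensor U A) :
  TV ~> TU := ct_arr TU (scomp (ct_cone TV) i).

Definition ct_post U A B (p : A ~> B) (TA : cotensor U A) (TB : cotensor U B) :
  TA ~> TB := ct_arr TB (scomp (post_map TA p) (ct_cone TA)).

Lemma ct_arrE U A (T : cotensor U A) X (g : smap U (hom X A)) n (u : U n) :
  kcomp (ct_cone T n u) (const n (ct_arr T g)) = g n u.
Proof. exact: ct_indE. Qed.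

Lemma leibniz_sq U V (i : smap U V) E B (p : E ~> B) (TVE : cotensor V E)
    (TUE : cotensor U E) (TVB : cotensor V B) (TUB : cotensor U B) :
  post (ct_restr i TVB TUB) (ct_post p TVE TVB)
    = post (ct_post p TUE TUB) (ct_restr i TVE TUE).
Proof.
rewrite /post !const0; apply: ct_uniq => n u a.
have aE : forall x : TVE ~> TUB, act a x = const n x.
  by move=> x; congr act; apply: dmapP => j; rewrite ffunE [a j]ord1.
rewrite !aE !const_comp !kcomp_assoc /ct_restr /ct_post !ct_arrE /= /post.
by rewrite -kcomp_assoc ct_arrE.
Qed.

Definition leibniz U V (i : smap U V) E B (p : E ~> B) (TVE : cotensor V E)
    (TUE : cotensor U E) (TVB : cotensor V B) (TUB : cotensor U B)
    (P : pullback (ct_restr i TVB TUB) (ct_post p TUE TUB)) : TVE ~> P :=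
  pb_ind P (leibniz_sq i p TVE TUE TVB TUB).

End Whiskering.

(** * Infinity-cosmoi *)

Record cosmos := Cosmos {
  cosmos_cat :> isoCat;
  cosmos_terminal : terminal cosmos_cat;
  cosmos_cotensor : forall U, fin_presented U ->
    forall A : cosmos_cat, cotensor U A;
  cosmos_pullback : forall (A E B : cosmos_cat) (f : A ~> B) (p : E ~> B),
    isofib p -> pullback f p;
  isofib_comp : forall (A B C : cosmos_cat) (g : B ~> C) (f : A ~> B),
    isofib g -> isofib f -> isofib (kcomp g f);
  isofib_iso : forall (A B : cosmos_cat) (f : A ~> B), is_iso f -> isofib f;
  isofib_bang : forall A : cosmos_cat, isofib (bang cosmos_terminal A 0);
  isofib_pb : forall (A E B : cosmos_cat) (f : A ~> B) (p : E ~> B)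
    (P : pullback f p), isofib p -> isofib (pb1 P);
  isofib_leibniz : forall U V (i : smap U V), smono i ->
    fin_presented U -> fin_presented V ->
    forall (E B : cosmos_cat) (p : E ~> B), isofib p ->
    forall (TVE : cotensor V E) (TUE : cotensor U E)
      (TVB : cotensor V B) (TUB : cotensor U B)
      (P : pullback (ct_restr i TVB TUB) (ct_post p TUE TUB)),
    isofib (leibniz TVE P);
  isofib_hom : forall (X E B : cosmos_cat) (p : E ~> B), isofib p ->
    qcat_isofib (post_map X p);
  cofibrant : forall (X E B : cosmos_cat) (p : E ~> B) (b : X ~> B),
    trivial_fib p -> exists e : X ~> E, kcomp p e = b }.

Section Products.
Variable K : cosmos.
Implicit Types A B X : K.

Definition kprod A B : pullback (bang (cosmos_terminal K) A 0) (bang _ B 0) :=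
  cosmos_pullback _ (isofib_bang B).

Definition kfst A B : kprod A B ~> A := pb1 (kprod A B).
Definition ksnd A B : kprod A B ~> B := pb2 (kprod A B).

Definition kpair A B X (a : X ~> A) (b : X ~> B) : X ~> kprod A B :=
  pb_ind (kprod A B)
    (bang_uniq (post (bang (cosmos_terminal K) A 0) a) (post (bang _ B 0) b)).

Lemma fst_pair A B X (a : X ~> A) (b : X ~> B) : kcomp (kfst A B) (kpair a b) = a.
Proof. by rewrite -[kfst A B]const0; apply: pb_ind1. Qed.

Lemma snd_pair A B X (a : X ~> A) (b : X ~> B) : kcomp (ksnd A B) (kpair a b) = b.
Proof. by rewrite -[ksnd A B]const0; apply: pb_ind2. Qed.

Lemma prod_uniq A B X (x y : X ~> kprod A B) :
  kcomp (kfst A B) x = kcomp (kfst A B) y -> kcomp (ksnd A B) x = kcomp (ksnd A B) y ->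
  x = y.
Proof. by move=> h1 h2; apply: pb_uniq; rewrite /post const0. Qed.

Lemma isofib_fst A B : isofib (kfst A B).
Proof. exact/isofib_pb/isofib_bang. Qed.

Definition pullback_sym A E B (f : A ~> B) (p : E ~> B) (P : pullback f p) :
  pullback p f.
Proof.
exists (pb P) (pb2 P) (pb1 P) (fun X n a e h => pb_ind P (esym h)).
- exact/esym/pb_sq.
- by move=> *; apply: pb_ind2.
- by move=> *; apply: pb_ind1.
- by move=> X n x y h1 h2; apply: pb_uniq.
Defined.

Lemma isofib_snd A B : isofib (ksnd A B).
Proof. exact: (isofib_pb (pullback_sym (kprod A B)) (isofib_bang A)). Qed.

End Products.

(** * Sliced cosmoi *)

Section Slice.
Variables (K : cosmos) (B : K).

Definition map_over_sset (E F : K) (p : E ~> B) (q : F ~> B) : sSet.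
Proof.
exists (fun n => {x : hom E F n | post q x = const n p})
  (fun m n a x => exist _ (act a (sval x)) (eq_trans (sfunP (post_map E q) a (sval x))
     (eq_trans (f_equal (act a) (svalP x)) (act_const a p)))).
- by move=> n [x h]; apply: eq_exist; rewrite /= act_id.
- by move=> l m n a b [x h]; apply: eq_exist; rewrite /= act_comp.
Defined.

Lemma map_over_qcat (E F : K) (p : E ~> B) (q : F ~> B) :
  isofib q -> is_quasicat (map_over_sset p q).
Proof.
move=> hq n k kn u; have [fib _] := @isofib_hom K E _ _ _ hq.
have @u' : smap (horn k) (hom E F).
  by exists (fun m x => sval (u m x)) => l m a x; rewrite sfunP.
have @v : smap (Delta n) (hom E B).
  by exists (fun m _ => const m p) => l m a x; rewrite act_const.
have [|l [l1 l2]] := fib n k kn u' v.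
  by move=> m x; apply: (svalP (u m x)).
have @l' : smap (Delta n) (map_over_sset p q).
  exists (fun m x => exist _ (l m x) (l2 m x)) => i m a x.
  by apply: eq_exist; rewrite /= sfunP.
exists l' => m x; move: (l1 m x); rewrite /=; case: (u m x) => y h /= e.
exact: eq_exist.
Qed.

Definition map_over (E F : K) (p : E ~> B) (q : F ~> B) (hq : isofib q) : qCat :=
  QCat (@map_over_qcat E F p q hq).

(* Precomposition with a functor t over B; the domains need not be isofibrations. *)
Definition precomp_over (D E F : K) (d : D ~> B) (p : E ~> B) (q : F ~> B)
    (hq : isofib q) (t : D ~> E) (ht : kcomp p t = d) :
  smap (map_over p hq) (map_over d hq).
Proof.
unshelve eexists.
- move=> n x; exists (pre t (sval x)).
  by rewrite /post /pre kcomp_assoc [kcomp _ (sval x)](svalP x) -const_comp ht.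
- by move=> m n a x; apply: eq_exist; rewrite /pre /= -kcomp_act act_const.
Defined.

Record slice_obj := SliceObj {
  slice_dom :> K;
  slice_fib : slice_dom ~> B;
  slice_isofib : isofib slice_fib }.

Definition slice_comp (E F G : slice_obj) n
    (g : map_over (slice_fib F) (slice_isofib G) n)
    (f : map_over (slice_fib E) (slice_isofib F) n) :
  map_over (slice_fib E) (slice_isofib G) n.
Proof.
exists (kcomp (sval g) (sval f)).
by rewrite /post kcomp_assoc [kcomp _ (sval g)](svalP g); apply: (svalP f).
Defined.

Definition slice_id (E : slice_obj) :
  map_over (slice_fib E) (slice_isofib E) 0.
Proof. by exists (idf E); rewrite /post -[idf E]const0 kcomp_idr. Defined.

Definition slice : isoCat.
Proof.
unshelve refine (@IsoCat slice_obj
  (fun E F => map_over (slice_fib E) (slice_isofib F))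
  slice_id slice_comp (fun E F f => isofib (sval f)) _ _ _ _).
- by move=> *; apply: eq_exist; apply: kcomp_act.
- by move=> *; apply: eq_exist; apply: kcomp_assoc.
- by move=> E F n [f h]; apply: eq_exist; apply: kcomp_idl.
- by move=> E F n [f h]; apply: eq_exist; apply: kcomp_idr.
Defined.

End Slice.

(** * Cartesian fibrations and groupoidal objects

    A 2-cell e' => e : X -> E of the homotopy 2-category is an arrow of the
    homotopy category of [hom X E]; [post p] and [pre g] are the whiskerings.
    Equality of 1-cells is strict, equality of 2-cells is [htpy]. *)

Section Fibrations.
Variable K : isoCat.
Implicit Types E B X Y : K.

Definition cartesian_cell E B (p : E ~> B) X (e' e : X ~> E) (chi : hom X E 1) :
    Prop :=
  [/\ arr e' e chi,
   (forall (e'' : X ~> E) (tau : hom X E 1) (gamma : hom X B 1),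
      arr e'' e tau -> arr (post p e'') (post p e') gamma ->
      htri gamma (post p chi) (post p tau) ->
      exists gamma' : hom X E 1,
        [/\ arr e'' e' gamma', htpy (post p gamma') gamma & htri gamma' chi tau]) &
   (forall gamma : hom X E 1, arr e' e' gamma -> htri gamma chi chi ->
      htpy (post p gamma) (const 1 (post p e')) -> hiso gamma)].

Definition cocartesian_cell E B (p : E ~> B) X (e e' : X ~> E) (chi : hom X E 1) :
    Prop :=
  [/\ arr e e' chi,
   (forall (e'' : X ~> E) (tau : hom X E 1) (gamma : hom X B 1),
      arr e e'' tau -> arr (post p e') (post p e'') gamma ->
      htri (post p chi) gamma (post p tau) ->
      exists gamma' : hom X E 1,
        [/\ arr e' e'' gamma', htpy (post p gamma') gamma & htri chi gamma' tau]) &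
   (forall gamma : hom X E 1, arr e' e' gamma -> htri chi gamma chi ->
      htpy (post p gamma) (const 1 (post p e')) -> hiso gamma)].

Definition cartesian_fib E B (p : E ~> B) : Prop :=
  [/\ isofib p,
   (forall X (e : X ~> E) (b : X ~> B) (alpha : hom X B 1),
      arr b (post p e) alpha ->
      exists (e' : X ~> E) (chi : hom X E 1),
        [/\ cartesian_cell p e' e chi, post p e' = b & htpy (post p chi) alpha]) &
   (forall X Y (g : Y ~> X) (e' e : X ~> E) (chi : hom X E 1),
      cartesian_cell p e' e chi ->
      cartesian_cell p (pre g e') (pre g e) (pre g chi))].

Definition cocartesian_fib E B (p : E ~> B) : Prop :=
  [/\ isofib p,
   (forall X (e : X ~> E) (b : X ~> B) (alpha : hom X B 1),
      arr (post p e) b alpha ->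
      exists (e' : X ~> E) (chi : hom X E 1),
        [/\ cocartesian_cell p e e' chi, post p e' = b & htpy (post p chi) alpha]) &
   (forall X Y (g : Y ~> X) (e e' : X ~> E) (chi : hom X E 1),
      cocartesian_cell p e e' chi ->
      cocartesian_cell p (pre g e) (pre g e') (pre g chi))].

Definition groupoidal E : Prop :=
  forall X (chi : hom X E 1), hiso chi.

End Fibrations.

(** * Modules and comma objects *)

Section Modules.
Variable K : cosmos.
Implicit Types A B : K.

(* An isofibration r over a base S, regarded, for an isofibration s : S ->> C,
   as a map of K/C from s r to s. *)
Definition slice_map C (S E : K) (s : S ~> C) (hs : isofib s) (r : E ~> S)
    (hr : isofib r) :
  (SliceObj (isofib_comp hs hr) : slice C) ~> (SliceObj hs : slice C).
Proof. by exists r; rewrite /post !const0. Defined.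

Record module A B := Module {
  mod_obj :> K;
  mod_fib : mod_obj ~> kprod A B;
  mod_isofib : isofib mod_fib;
  mod_cartesian : cartesian_fib (slice_map (isofib_fst A B) mod_isofib);
  mod_cocartesian : cocartesian_fib (slice_map (isofib_snd A B) mod_isofib);
  mod_groupoidal :
    groupoidal (SliceObj mod_isofib : slice (kprod A B)) }.

Definition ev B (T : cotensor (Delta 1) B) (k : 'I_2) : T ~> B :=
  ct_cone T 0 (dconst 0 k).

Definition ev10 B (T : cotensor (Delta 1) B) : T ~> kprod B B :=
  kpair (ev T ord_max) (ev T ord0).

(* [ev10] and [comma_fib] list evaluation at 1, resp. the projection to A, first. *)
Definition comma A B (T : cotensor (Delta 1) B) (f : A ~> B) :=
  pullback (kpair (kcomp f (kfst A B)) (ksnd A B)) (ev10 T).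

Section Comma.
Variables (A B : K) (T : cotensor (Delta 1) B) (f : A ~> B) (C : comma T f).

Definition comma_fib : C ~> kprod A B := pb1 C.
Definition comma1 : C ~> A := kcomp (kfst A B) comma_fib.
Definition comma0 : C ~> B := kcomp (ksnd A B) comma_fib.

(* The canonical 2-cell from p_0 to f p_1, obtained from the generic arrow of B;
   see [comma_cellP]. *)
Definition comma_cell : hom C B 1 := pre (pb2 C) (ct_cone T 1 (did 1)).

Lemma comma_fibE (t : A ~> C) :
  kcomp comma1 t = idf A -> kcomp comma0 t = f -> kcomp comma_fib t = kpair (idf A) f.
Proof.
move=> h1 h0; apply: prod_uniq; rewrite kcomp_assoc.
- by rewrite fst_pair.
- by rewrite snd_pair.
Qed.

Lemma comma_cellP : arr comma0 (kcomp f comma1) comma_cell.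
Proof.
have e0 := congr1 (kcomp (ksnd B B)) (pb_sq C); rewrite !kcomp_assoc !snd_pair in e0.
have e1 := congr1 (kcomp (kfst B B)) (pb_sq C); rewrite !kcomp_assoc !fst_pair in e1.
split; rewrite /src /tgt /face /comma_cell /pre -kcomp_act act_const -sfunP const0.
- rewrite /comma0 /comma_fib e0 /ev; congr (kcomp (ct_cone T 0 _) _).
  by apply: dmapP => i; rewrite !ffunE; apply: val_inj; rewrite (ord1 i).
- rewrite /comma1 kcomp_assoc e1 /ev; congr (kcomp (ct_cone T 0 _) _).
  by apply: dmapP => i; rewrite !ffunE; apply: val_inj; rewrite (ord1 i).
Qed.

End Comma.
End Modules.

(* Main.v *)
From mathcomp Require Import all_boot boolp zify.
Require Import Defs.

(** Write [q = (qA, qB)] for the isofibration of the module over [A * B].  The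
    proof rests on [q] being cartesian over [A] and groupoidal over [A * B].

    The inverse of precomposition with [t] is given by cartesian transport.  Let
    [D] be the comma object of [qB]: it classifies an element [e] of [E] together
    with an arrow [b -> qB e].  The generic arrow, paired with the identity in
    [A], has a cartesian lift [chi : r => e] in the slice over [A], where
    [r : D -> E] ([cartesian_lift]).  An element [y] over [(id, f)] is sent to
    [r (y p1, phi)], which lies over [(p1, p0)]; this formula is simplicial in
    [y].

    Starting from [x] over the comma object, the unit [eta : id => t p1]
    ([comma_unit]) gives an arrow [x eta : x => x t p1] over [(id, phi)], and
    cartesianness factors it through a comparison [x => r (x t p1, phi)] over
    [A * B].  Starting from [y] over [(id, f)], the cell [chi] itself restricts
    to a comparison [r (y, phi t) => y], which lies over an identity because
    [phi t] is homotopic to one.  Groupoidality makes both comparisons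
    invertible.

    An equivalence of quasi-categories asks for more than invertible arrows, one
    for each [x]: the homotopies have to be simplicial in [x] and parametrised by
    the interval [J].  Two ingredients provide this.  Naturality is obtained by
    building each comparison once, on a universal object: the object of arrows of
    [E] that lie over identities of [A] ([fibre_arrows]) for the first one, and
    the pullback of [E] along [(id, f)] for the second.  That an invertible arrow
    of a quasi-category extends to a map out of [J] is Joyal's theorem on outer
    horns ([hiso_extends]), proved here by the decalage argument: an outer horn
    whose first edge is invertible becomes, after slicing, a lower dimensional
    one for a right fibration, and in dimension one the lifting problem is
    solved by lifting an inverse and then a triangle. *)

Set Implicit Arguments.
Unset Strict Implicit.
Unset Printing Implicit Defensive.

Local Open Scope cosmos_scope.

(** * Maps of the simplex category given by functions on numbers *)

Lemma dmap_eq m n (a b : dmap m n) : (forall i, a i = b i :> nat) -> a = b.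
Proof. by move=> h; apply: dmapP => i; apply/val_inj/h. Qed.

Lemma dcompE l m n (a : dmap m n) (b : dmap l m) i : dcomp a b i = a (b i).
Proof. by rewrite ffunE. Qed.

Lemma didE n i : did n i = i.
Proof. by rewrite ffunE. Qed.

Lemma dconstE m n (k : 'I_n.+1) i : dconst m k i = k.
Proof. by rewrite ffunE. Qed.

(** Cofaces and codegeneracies are indexed by plain numbers, without a bound, so
    that the simplicial identities become inequalities between numbers; the
    truncation by [minn] keeps the definition total. *)
Section NatMaps.
Variables (m n : nat) (F : nat -> nat).
Hypothesis Fmono : forall i j, i <= j -> F i <= F j.

Lemma dmap_nat_subproof (i j : 'I_m.+1) :
  i <= j -> @inord n (minn n (F i)) <= @inord n (minn n (F j)).
Proof.
move=> ij; rewrite !inordK; try lia.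
by have := Fmono ij; lia.
Qed.

Definition dmap_nat : dmap m n := dmap_of dmap_nat_subproof.

Lemma dmap_natE i : dmap_nat i = minn n (F i) :> nat.
Proof. by rewrite ffunE inordK //; lia. Qed.
End NatMaps.

Lemma bump_mono k i j : i <= j -> bump k i <= bump k j.
Proof. by rewrite /bump; lia. Qed.

Lemma unbump_mono k i j : i <= j -> unbump k i <= unbump k j.
Proof. by rewrite /unbump; lia. Qed.

Definition coface (k n : nat) : dmap n n.+1 := dmap_nat n n.+1 (@bump_mono k).
Definition codeg (k n : nat) : dmap n.+1 n := dmap_nat n.+1 n (@unbump_mono k).

Lemma cofaceE k n i : coface k n i = bump k i :> nat.
Proof. by rewrite dmap_natE /bump; have := ltn_ord i; lia. Qed.

Lemma codegE k n i : codeg k n i = minn n (unbump k i) :> nat.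
Proof. exact: dmap_natE. Qed.

Lemma dface_coface n (k : 'I_n.+2) : dface k = coface k n.
Proof. by apply: dmap_eq => i; rewrite cofaceE ffunE. Qed.

Definition nface (X : sSet) k n (x : X n.+1) : X n := act (coface k n) x.

Lemma faceE (X : sSet) n (k : 'I_n.+2) (x : X n.+1) : face k x = nface k x.
Proof. by rewrite /face dface_coface. Qed.

Lemma srcE (X : sSet) (e : X 1) : src e = nface 1 e.
Proof. exact: faceE. Qed.

Lemma tgtE (X : sSet) (e : X 1) : tgt e = nface 0 e.
Proof. exact: faceE. Qed.

Lemma htriE (X : sSet) (f g h : X 1) :
  htri f g h <-> exists s : X 2, [/\ nface 2 s = f, nface 0 s = g & nface 1 s = h].
Proof.
by split=> -[s] []; rewrite ?faceE ?inordK // => *; exists s; rewrite ?faceE ?inordK.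
Qed.

Lemma sfun_nface (X Y : sSet) (p : smap X Y) k n (x : X n.+1) :
  p n (nface k x) = nface k (p _ x).
Proof. exact: sfunP. Qed.

Lemma sfun_const (X Y : sSet) (p : smap X Y) n (x : X 0) :
  p n (const n x) = const n (p 0 x).
Proof. exact: sfunP. Qed.

Ltac dmap_lia := let i := fresh "i" in apply: dmap_eq; intro i; move: (ltn_ord i);
  rewrite ?(dcompE, cofaceE, codegE, didE, dconstE, dmap_natE) /bump /unbump /=; lia.

Lemma nface_nface (X : sSet) i j n (x : X n.+2) :
  i <= j -> nface i (nface j.+1 x) = nface j (nface i x).
Proof. by move=> ij; rewrite /nface !act_comp; congr act; dmap_lia. Qed.

Lemma nface_const (X : sSet) k n (x : X 0) : nface k (const n.+1 x) = const n x.
Proof. exact: act_const. Qed.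

(** * Horns presented by their faces *)

(** The matching condition for the faces [x j], for [j] different from [k], of a
    horn of dimension [n.+1].  In dimension one a horn is a single vertex. *)
Definition compat (X : sSet) (k n : nat) : (nat -> X n) -> Prop :=
  match n with
  | 0 => fun _ => True
  | n'.+1 => fun x => forall i j, i < j -> j <= n'.+2 -> i != k -> j != k ->
      nface i (x j) = nface j.-1 (x i)
  end.

Definition horn_lift (Y X : sSet) (p : smap Y X) (n k : nat) : Prop :=
  forall (x : nat -> Y n) (b : X n.+1), compat k x ->
    (forall j, j <= n.+1 -> j != k -> p n (x j) = nface j b) ->
    exists y : Y n.+1,
      p _ y = b /\ forall j, j <= n.+1 -> j != k -> nface j y = x j.

(** A simplex of the horn misses some vertex [j <> k], so it factors through the
    face [x j]; when it misses two vertices it factors through the common face of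
    the two, where [compat] makes the two values agree. *)
Lemma horn_smap (X : sSet) n (k : 'I_n.+2) (x : nat -> X n) : compat k x ->
  exists u : smap (horn k) X, forall m (a : horn k m) j, j <= n.+1 -> j != k ->
    (forall i, sval a i != j :> nat) -> u m a = act (dcomp (codeg j n) (sval a)) (x j).
Proof.
move=> hx.
have indep m (a : dmap m n.+1) i j : i < j -> j <= n.+1 -> i != k -> j != k ->
    (forall l, a l != i :> nat) -> (forall l, a l != j :> nat) ->
    act (dcomp (codeg i n) a) (x i) = act (dcomp (codeg j n) a) (x j).
  case: n k x hx a => [|n] k x /= hx a ij jn ik jk ai aj.
    by have := ltn_ord k; lia.
  pose b := dcomp (codeg i n) (dcomp (codeg j n.+1) a).
  have -> : dcomp (codeg i n.+1) a = dcomp (coface j.-1 n) b.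
    apply: dmap_eq => l; rewrite !(dcompE, cofaceE, codegE) /bump /unbump.
    move: (ai l) (aj l) (ltn_ord (a l)); move: (a l : nat) => v vi vj vn.
    by case: (ltngtP v i) vi; case: (ltngtP v j) vj => //; lia.
  have -> : dcomp (codeg j n.+1) a = dcomp (coface i n) b.
    apply: dmap_eq => l; rewrite !(dcompE, cofaceE, codegE) /bump /unbump.
    move: (ai l) (aj l) (ltn_ord (a l)); move: (a l : nat) => v vi vj vn.
    by case: (ltngtP v i) vi; case: (ltngtP v j) vj => //; lia.
  by rewrite -[LHS]act_comp -[RHS]act_comp; congr act; apply/esym/hx.
have ex m (a : horn k m) : exists j : 'I_n.+2, (j != k) && [forall i, sval a i != j].
  by case: a => a /= /existsP.
pose c m a := xchoose (ex m a).
have cP m a : (c m a != k) /\ forall i, sval a i != c m a.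
  by have /andP[h /forallP] := xchooseP (ex m a).
have key m (a : horn k m) j : j <= n.+1 -> j != k ->
    (forall i, sval a i != j :> nat) ->
    act (dcomp (codeg (c m a) n) (sval a)) (x (c m a))
    = act (dcomp (codeg j n) (sval a)) (x j).
  move=> jn jk aj; have [ck ac] := cP m a.
  have [lt|lt|-> //] := ltngtP (c m a) j; first by apply: indep => //.
  by apply/esym; apply: indep => //; rewrite -ltnS.
unshelve eexists.
- by exists (fun m a => act (dcomp (codeg (c m a) n) (sval a)) (x (c m a))) => m l b a;
    rewrite (key _ _ (c l a)) //= ?act_comp;
    [congr act; dmap_lia | rewrite -ltnS | have [] := cP l a
      | move=> i; have [_] := cP l a; rewrite ffunE; apply].
- by move=> m a j /=; apply: key.
Qed.

Lemma rlp_horn_lift (Y X : sSet) (p : smap Y X) n (k : 'I_n.+2) :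
  rlp (horn_incl k) p -> horn_lift p n k.
Proof.
move=> h x b cx hp; have [u hu] := horn_smap cx.
have v_nat m l (a : dmap m l) (y : Delta n.+1 l) : act (act a y) b = act a (act y b).
  by rewrite act_comp.
have [m y|l [l1 l2]] := h u (SMap v_nat).
  case: y => a /= ha; have /existsP[j /andP[jk /forallP aj]] := ha.
  rewrite (hu _ _ j) //=; last by rewrite -ltnS.
  rewrite sfunP hp //; last by rewrite -ltnS.
  rewrite act_comp; congr act; apply: dmap_eq => i.
  rewrite !(dcompE, cofaceE, codegE) /bump /unbump.
  have : a i != j :> nat by apply: aj.
  by have := ltn_ord (a i); have := ltn_ord j; lia.
exists (l _ (did _)); split=> [|j jn jk]; first by rewrite l2 /= act_id.
rewrite /nface -sfunP.
have aj i : coface j n i != j :> nat by rewrite cofaceE /bump; lia.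
have ha : in_horn k (coface j n).
  apply/existsP; exists (Ordinal (jn : j < n.+2)); rewrite jk /=.
  by apply/forallP => i; apply: aj.
have := l1 _ (exist (fun a : dmap n n.+1 => in_horn k a) _ ha); rewrite (hu _ _ j) //=.
have -> : dcomp (codeg j n) (coface j n) = did n by dmap_lia.
by rewrite act_id => <-; congr (l _ _); dmap_lia.
Qed.

Definition inner_fib (Y X : sSet) (p : smap Y X) : Prop :=
  forall n k, 0 < k < n.+1 -> horn_lift p n k.

(** The lifting condition includes the horns of dimension one with vertex 1: an
    arrow lifts as soon as its target does. *)
Definition right_fib (Y X : sSet) (p : smap Y X) : Prop :=
  forall n k, 0 < k <= n.+1 -> horn_lift p n k.

Lemma inner_horns_inner_fib (Y X : sSet) (p : smap Y X) :
  (forall n (k : 'I_n.+1), 0 < k < n -> rlp (horn_incl k) p) -> inner_fib p.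
Proof.
move=> h n k kn; have kn' : k < n.+2 by lia.
exact: (@rlp_horn_lift _ _ _ _ (Ordinal kn') (h _ _ _)).
Qed.

Lemma right_fib_inner_fib (Y X : sSet) (p : smap Y X) : right_fib p -> inner_fib p.
Proof. by move=> h n k kn; apply: h; lia. Qed.

Definition point : sSet.
Proof. by exists (fun=> unit) (fun _ _ _ _ => tt) => [? []|]. Defined.

Definition to_point (X : sSet) : smap X point.
Proof. by exists (fun _ _ => tt). Defined.

(** Quasi-categories as inner fibrations over a point, so that statements about
    inner fibrations cover the absolute case. *)
Definition inner_kan (X : sSet) : Prop := inner_fib (to_point X).

Lemma qcat_inner_kan (X : qCat) : inner_kan X.
Proof.
apply: inner_horns_inner_fib => n k kn u v _; have [l hl] := qcatP kn u.
by exists l; split=> // m x; case: (v m x).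
Qed.

Lemma inner_kan_fill (X : sSet) n k (x : nat -> X n) :
  inner_kan X -> 0 < k < n.+1 -> compat k x ->
  exists y : X n.+1, forall j, j <= n.+1 -> j != k -> nface j y = x j.
Proof.
move=> h kn cx.
by have [//|y [_ hy]] := h _ _ kn x tt cx; exists y.
Qed.

Lemma inner_fib_inner_kan (Y X : sSet) (p : smap Y X) :
  inner_fib p -> inner_kan X -> inner_kan Y.
Proof.
move=> hp hX n k kn x [] cx _.
have [|b hb] := @inner_kan_fill X n k (fun j => p n (x j)) hX kn.
  by case: n x cx kn => [|n] //= x cx kn i j *; rewrite -!sfun_nface cx.
have [|y [_ hy]] := hp _ _ kn x b cx; first by move=> j jn jk; rewrite hb.
by exists y.
Qed.

(** * The homotopy category *)

Section HomotopyCategory.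
Variable X : sSet.
Implicit Types f g h : X 1.

Lemma htri_ends f g h : htri f g h -> [/\ src h = src f, tgt f = src g & tgt h = tgt g].
Proof.
case/htriE=> s [<- <- <-]; rewrite !srcE !tgtE.
by rewrite (@nface_nface _ 1 1) // (@nface_nface _ 0 1) // (@nface_nface _ 0 0).
Qed.

Lemma htri_idl f : htri (const 1 (src f)) f f.
Proof.
apply/htriE; exists (act (codeg 0 1) f); rewrite srcE /nface /const !act_comp.
by split; rewrite -1?[RHS]act_id ?act_comp; congr act; dmap_lia.
Qed.

Lemma htri_idr f : htri f (const 1 (tgt f)) f.
Proof.
apply/htriE; exists (act (codeg 1 1) f); rewrite tgtE /nface /const !act_comp.
by split; rewrite -1?[RHS]act_id ?act_comp; congr act; dmap_lia.
Qed.

Lemma htpy_refl f : htpy f f.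
Proof. exact: htri_idr. Qed.

Hypothesis hX : inner_kan X.

(** Associativity of composition, from tetrahedra with edges [eij]: this one
    produces the face opposite the vertex 1, the next one the face opposite the
    vertex 2. *)
Lemma htri_fill1 (e01 e12 e23 e02 e13 e03 : X 1) :
  htri e01 e12 e02 -> htri e12 e23 e13 -> htri e01 e13 e03 -> htri e02 e23 e03.
Proof.
move=> /htriE[s3 [a1 a2 a3]] /htriE[s0 [b1 b2 b3]] /htriE[s2 [c1 c2 c3]].
have [//||y hy] :=
    @inner_kan_fill _ 2 1 (fun j => if j is 0 then s0 else if j is 2 then s2 else s3) hX.
  by move=> [|[|[|[|i]]]] [|[|[|[|j]]]] //= _ _ _ _; congruence.
apply/htriE; exists (nface 1 y); rewrite -a3 -b2 -c3.
have <- : nface 3 y = s3 by rewrite hy.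
have <- : nface 0 y = s0 by rewrite hy.
have <- : nface 2 y = s2 by rewrite hy.
by split; [rewrite (@nface_nface _ 1 2) | rewrite (@nface_nface _ 0 0)
  | rewrite (@nface_nface _ 1 1)].
Qed.

Lemma htri_fill2 (e01 e12 e23 e02 e13 e03 : X 1) :
  htri e01 e12 e02 -> htri e12 e23 e13 -> htri e02 e23 e03 -> htri e01 e13 e03.
Proof.
move=> /htriE[s3 [a1 a2 a3]] /htriE[s0 [b1 b2 b3]] /htriE[s1 [c1 c2 c3]].
have [//||y hy] :=
    @inner_kan_fill _ 2 2 (fun j => if j is 0 then s0 else if j is 1 then s1 else s3) hX.
  by move=> [|[|[|[|i]]]] [|[|[|[|j]]]] //= _ _ _ _; congruence.
apply/htriE; exists (nface 2 y); rewrite -a1 -b3 -c3.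
have <- : nface 3 y = s3 by rewrite hy.
have <- : nface 0 y = s0 by rewrite hy.
have <- : nface 1 y = s1 by rewrite hy.
by split; [rewrite (@nface_nface _ 2 2) | rewrite (@nface_nface _ 0 1)
  | rewrite (@nface_nface _ 1 1)].
Qed.

Lemma src_const (x : X 0) : src (const 1 x) = x.
Proof. by rewrite srcE nface_const const0. Qed.

Lemma tgt_const (x : X 0) : tgt (const 1 x) = x.
Proof. by rewrite tgtE nface_const const0. Qed.

Lemma htri_const (x : X 0) : htri (const 1 x) (const 1 x) (const 1 x).
Proof. by have := htri_idl (const 1 x); rewrite src_const. Qed.

Lemma htpy_tgt f g : htpy f g -> tgt g = tgt f.
Proof. by case/htri_ends => _ _ ->; rewrite tgt_const. Qed.

Lemma htpy_trans f g h : htpy f g -> htpy g h -> htpy f h.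
Proof.
move=> fg gh; apply: (htri_fill2 fg _ gh).
by rewrite (htpy_tgt fg); apply: htri_const.
Qed.

Lemma htpy_idl f g : htpy f g -> htri (const 1 (src f)) f g.
Proof. by move=> fg; apply: (htri_fill2 (htri_idl f) (htri_idr f) fg). Qed.

Lemma htpy_sym f g : htpy f g -> htpy g f.
Proof.
move=> fg; rewrite /htpy (htpy_tgt fg).
by apply: (htri_fill1 fg (htri_const _) (htri_idr f)).
Qed.

(** In a monoid an element with a left inverse that is itself left invertible is
    invertible; the same argument works for arrows up to homotopy. *)
Lemma hiso_of_inverses f g h :
  htri g f (const 1 (tgt f)) -> htri h g (const 1 (tgt g)) -> hiso f.
Proof.
move=> gf hg; have [e1 e2 _] := htri_ends gf; have [e3 e4 _] := htri_ends hg.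
rewrite !src_const in e1 e3.
have hf : htri h (const 1 (tgt f)) f.
  apply: (htri_fill2 hg gf _).
  by rewrite e2; apply: htri_idl.
exists g; split=> //; rewrite -e2.
apply: (htri_fill1 hf _ hg).
by rewrite e1; apply: htri_idl.
Qed.
End HomotopyCategory.

Lemma htri_map (X Y : sSet) (p : smap X Y) f g h :
  htri f g h -> htri (p _ f) (p _ g) (p _ h).
Proof.
move=> /htriE[s [<- <- <-]]; apply/htriE; exists (p _ s).
by rewrite -!sfun_nface.
Qed.

Lemma src_map (X Y : sSet) (p : smap X Y) f : src (p _ f) = p _ (src f).
Proof. by rewrite !srcE sfun_nface. Qed.

Lemma tgt_map (X Y : sSet) (p : smap X Y) f : tgt (p _ f) = p _ (tgt f).
Proof. by rewrite !tgtE sfun_nface. Qed.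

Lemma htpy_map (X Y : sSet) (p : smap X Y) f g :
  htpy f g -> htpy (p _ f) (p _ g).
Proof. by move/(htri_map p); rewrite /htpy tgt_map sfun_const. Qed.

Lemma hiso_map (X Y : sSet) (p : smap X Y) f : hiso f -> hiso (p _ f).
Proof.
case=> g [[gs gt] fg gf]; exists (p _ g); split.
- by split; rewrite !(src_map, tgt_map) ?gs ?gt.
- by rewrite src_map -sfun_const; apply: htri_map.
- by rewrite tgt_map -sfun_const; apply: htri_map.
Qed.

Lemma hiso_inv (X : sSet) (f : X 1) : hiso f -> exists2 g, hiso g &
  [/\ src g = tgt f, tgt g = src f,
      htri f g (const 1 (src f)) & htri g f (const 1 (tgt f))].
Proof.
case=> g [[gs gt] fg gf]; exists g; last by split.
by exists f; split; rewrite ?gs ?gt.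
Qed.

(** * Decalage *)

(** [dec a] is the join of [a] with a point: it preserves the last vertex.
    Precomposition with it makes the simplices of dimension [n.+1] the
    n-simplices of the coproduct of all slices of [X] over its vertices. *)
Definition decf m n (a : dmap m n) (i : nat) : nat :=
  if i <= m then nat_of_ord (a (inord i)) else n.+1.

Lemma decf_mono m n (a : dmap m n) i j : i <= j -> decf a i <= decf a j.
Proof.
rewrite /decf => ij; case: (leqP j m) => jm; last first.
  by case: ifP => // im; have := ltn_ord (a (inord i)); lia.
rewrite (leq_trans ij jm); apply: dmap_mono.
by rewrite !inordK //; lia.
Qed.

Definition dec m n (a : dmap m n) : dmap m.+1 n.+1 := dmap_nat m.+1 n.+1 (decf_mono a).

Lemma decE m n (a : dmap m n) i : dec a i = decf a i :> nat.
Proof.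
by rewrite dmap_natE /decf; case: ifP => _; have := ltn_ord (a (inord i)); lia. Qed.

Lemma dec_id n : dec (did n) = did n.+1.
Proof.
apply: dmap_eq => i; rewrite decE /decf !didE; have := ltn_ord i.
by case: ifP => h; [rewrite inordK | lia].
Qed.

Lemma dec_comp l m n (a : dmap m n) (b : dmap l m) :
  dec (dcomp a b) = dcomp (dec a) (dec b).
Proof.
apply: dmap_eq => i; rewrite dcompE !decE /decf.
case: ifP => h; last by rewrite ltnn.
rewrite dcompE -ltnS ltn_ord; congr (nat_of_ord (a _)).
by apply: val_inj; rewrite /= inordK.
Qed.

Definition Dec (X : sSet) : sSet.
Proof.
exists (fun n => X n.+1) (fun m n a x => act (dec a) x).
- by move=> n x; rewrite dec_id act_id.
- by move=> l m n a b x; rewrite dec_comp act_comp.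
Defined.

Lemma dec_last m n (a : dmap m n) :
  dcomp (coface n.+1 n) a = dcomp (dec a) (coface m.+1 m).
Proof.
apply: dmap_eq => i; rewrite !dcompE decE /decf !cofaceE /bump.
have im := ltn_ord i; have ai := ltn_ord (a i).
have -> : (n < a i) = false by lia.
have -> : (m < i) = false by lia.
have -> : false + i <= m by lia.
by congr (nat_of_ord (a _)); apply: val_inj; rewrite /= inordK.
Qed.

Lemma dec_coface k n : k <= n.+1 -> dec (coface k n) = coface k n.+1.
Proof.
move=> kn; apply: dmap_eq => i; rewrite decE /decf !cofaceE /bump.
by have := ltn_ord i; case: ifP => h; rewrite ?inordK //; lia.
Qed.

Lemma nface_Dec (X : sSet) k n (x : Dec X n.+1) :
  k <= n.+1 -> nface k x = nface k (x : X n.+2).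
Proof. by move=> kn; rewrite /nface /= dec_coface. Qed.

Definition Dec_proj X : smap (Dec X) X.
Proof.
by exists (fun n x => nface n.+1 x) => m n a x; rewrite /nface /= !act_comp dec_last.
Defined.

(** For [p : Y -> X], the base of the relative slice: an n-simplex of [Y] with
    an extension of its image by one last vertex. *)
Section RelDec.
Variables (Y X : sSet) (p : smap Y X).

Definition DecPb : sSet.
Proof.
exists (fun n => {yx : Y n * X n.+1 | p n yx.1 = nface n.+1 yx.2})
  (fun m n a z => exist _ (act a (sval z).1, act (dec a) (sval z).2)
    (eq_trans (sfunP p a (sval z).1) (eq_trans (f_equal (act a) (svalP z))
      (esym (sfunP (Dec_proj X) a (sval z).2))))).
- by move=> n [[y x] h]; apply: eq_exist; rewrite /= dec_id !act_id.
- by move=> l m n a b [[y x] h]; apply: eq_exist; rewrite /= dec_comp !act_comp.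
Defined.

Definition DecPb_fst : smap DecPb Y.
Proof. by exists (fun n z => (sval z).1). Defined.

Lemma Dec_compare_subproof n (y : Dec Y n) :
  p n (nface n.+1 (y : Y n.+1)) = nface n.+1 (p n.+1 y).
Proof. by rewrite sfun_nface. Qed.

Definition Dec_compare : smap (Dec Y) DecPb.
Proof.
exists (fun n y => exist (fun z => p n z.1 = nface n.+1 z.2)
  (nface n.+1 (y : Y n.+1), p n.+1 y)
  (Dec_compare_subproof y)).
move=> m n a y; apply: eq_exist => /=; congr pair; last by rewrite sfunP.
exact: (sfunP (Dec_proj Y)).
Defined.
End RelDec.

(** A horn of dimension [n.+1] in the decalage, together with its projection
    [z], is a horn of dimension [n.+2]; since a last vertex has been added, the
    horns with [k <= n.+1] are inner. *)
Lemma dec_fill (Y X : sSet) (p : smap Y X) n k (x : nat -> Dec Y n) (z : Y n.+1)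
    (b : X n.+2) :
  inner_fib p -> 0 < k <= n.+1 -> compat k x ->
  (forall j, j <= n.+1 -> j != k -> nface n.+1 (x j : Y n.+1) = nface j z) ->
  (forall j, j <= n.+1 -> j != k -> p _ (x j : Y n.+1) = nface j b) ->
  p _ z = nface n.+2 b ->
  exists y : Y n.+2, [/\ p _ y = b, nface n.+2 y = z &
    forall j, j <= n.+1 -> j != k -> nface j y = x j].
Proof.
move=> hp kn cx xz xb zb.
have [||j jn jk|y [yb hy]] :=
    hp _ k _ (fun j => if j <= n.+1 then (x j : Y n.+1) else z) b.
- by lia.
- move=> /= i j ij jn ik jk; have -> : i <= n.+1 by lia.
  have [jn'|jn'] := leqP j n.+1; last first.
    have -> : j = n.+2 by lia.
    by rewrite xz //; lia.
  case: n x z b cx xz xb zb kn jn jn' => [|n] x z b cx xz xb zb kn jn jn'; first by lia.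
  by have := cx _ _ ij jn' ik jk; rewrite !nface_Dec //; lia.
- have [jn'|jn'] := leqP j n.+1; first exact: xb.
  by have -> : j = n.+2 by lia.
exists y; split=> // [|j jn jk].
  by rewrite hy ?ltnn //; lia.
by rewrite hy ?jn //; lia.
Qed.

Lemma Dec_compare_right_fib (Y X : sSet) (p : smap Y X) :
  inner_fib p -> right_fib (Dec_compare p).
Proof.
move=> hp n k kn x [[z b] zb] cx hx.
have hx1 j : j <= n.+1 -> j != k -> nface n.+1 (x j : Y n.+1) = nface j z.
  by move=> jn jk; have /(congr1 sval)/(congr1 fst) := hx j jn jk.
have hx2 j : j <= n.+1 -> j != k -> p _ (x j : Y n.+1) = nface j b.
  move=> jn jk; have /(congr1 sval)/(congr1 snd) /= -> := hx j jn jk.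
  by rewrite dec_coface.
have [y [yb yz hy]] := dec_fill hp kn cx hx1 hx2 zb.
exists y; split; first by apply: eq_exist; rewrite yb yz.
by move=> j jn jk; rewrite nface_Dec // hy.
Qed.

Lemma DecPb_fst_right_fib (Y X : sSet) (p : smap Y X) :
  inner_kan X -> right_fib (DecPb_fst p).
Proof.
move=> hX n k kn x z cx hx.
have cx2 : @compat (Dec X) k n (fun j => (sval (x j)).2).
  case: n x z cx hx kn => [|n] //= x z cx hx kn i j ij jn ik jk.
  by have /(congr1 sval)/(congr1 snd) := cx i j ij jn ik jk.
have hx2 j : j <= n.+1 -> j != k -> nface n.+1 (sval (x j)).2 = nface j (p _ z).
  by move=> jn jk; rewrite -(svalP (x j)) [(sval (x j)).1](hx j jn jk) sfun_nface.
have [//|//|y [_ yz hy]] := @dec_fill _ _ (to_point X) n k _ (p _ z) tt hX kn cx2 hx2.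
exists (exist (fun z => p _ z.1 = nface n.+2 z.2) (z, y) (esym yz)); split=> // j jn jk.
have := hx j jn jk; have := hy j jn jk.
case: (x j) => -[u v] h /= yj zj; apply: eq_exist; congr pair => //=.
by rewrite dec_coface.
Qed.

(** * Special outer horns *)

Section RightFibrations.
Variables (Y X : sSet) (p : smap Y X).
Hypotheses (hp : right_fib p) (hX : inner_kan X).

Lemma right_fib_lift_triangle (f : Y 1) (e' : X 1) :
  htri e' (p _ f) (const 1 (p _ (tgt f))) ->
  exists2 g, p _ g = e' & htri g f (const 1 (tgt f)).
Proof.
case/htriE => s [s2 s0 s1].
have [//|||y [ys hy]] :=
    @hp 1 2 _ (fun j => if j is 0 then f else const 1 (tgt f)) s.
- by move=> [|[|i]] [|[|[|j]]] //= _ _ _ _; rewrite nface_const const0 tgtE.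
- by move=> [|[|[|j]]] //= _ _; rewrite ?s0 // s1 sfun_const.
exists (nface 2 y); first by rewrite sfun_nface ys.
by apply/htriE; exists y; split=> //; rewrite hy.
Qed.

Lemma right_fib_inverse (f : Y 1) : hiso (p _ f) ->
  exists g, [/\ hiso (p _ g), tgt g = src f & htri g f (const 1 (tgt f))].
Proof.
case/hiso_inv=> e' he' [_ _ _ h]; rewrite tgt_map in h.
have [g ge gf] := right_fib_lift_triangle h; exists g; split=> //; first by rewrite ge.
by have [] := htri_ends gf.
Qed.

(** Lifting triangles gives every arrow over an invertible one a left inverse
    that again lies over an invertible arrow. *)
Lemma right_fib_conservative (f : Y 1) : hiso (p _ f) -> hiso f.
Proof.
move=> hf; have [g [hg _ gf]] := right_fib_inverse hf.
have [h [_ _ hg']] := right_fib_inverse hg.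
apply: (hiso_of_inverses _ gf hg').
by apply: (inner_fib_inner_kan (right_fib_inner_fib hp)).
Qed.

(** Right fibrations lift arrows from their targets.  For an invertible arrow a
    lift from the source is found by first lifting its inverse and then the
    triangle that exhibits the two as inverse. *)
Lemma right_fib_lift_iso (b : X 1) (a : Y 0) : hiso b -> p _ a = src b ->
  exists2 f, p _ f = b & src f = a.
Proof.
case/hiso_inv=> e' _ [e1 e2 be eb] ab.
have [//||g [gb gt]] := @hp 0 1 _ (fun=> a) e' I.
  by move=> [|[|j]] // _ _; rewrite ab -e2 tgtE.
have ga : tgt g = a by rewrite tgtE gt.
have [|f fb fg] := @right_fib_lift_triangle g b _.
  by rewrite gb ga ab.
exists f => //; have [<- _ _] := htri_ends fg.
by rewrite src_const.
Qed.
End RightFibrations.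

Definition first_arrow n : dmap 1 n.+1 := dmap_nat 1 n.+1 (F := id) (fun _ _ h => h).

Definition first_edge (X : sSet) n (x : X n.+1) : X 1 := act (first_arrow n) x.

Lemma first_edge_map (X Y : sSet) (p : smap X Y) n (x : X n.+1) :
  first_edge (p _ x) = p _ (first_edge x).
Proof. by rewrite /first_edge sfunP. Qed.

Lemma first_edge_nface (X : sSet) n k (x : X n.+2) : 1 < k ->
  first_edge (nface k x) = first_edge x.
Proof. by move=> k1; rewrite /first_edge /nface act_comp; congr act; dmap_lia. Qed.

Lemma first_edge1 (X : sSet) (x : X 1) : first_edge x = x.
Proof. by rewrite -[RHS]act_id; congr act; dmap_lia. Qed.

Definition special_lift (Y X : sSet) (p : smap Y X) n : Prop :=
  forall (x : nat -> Y n) (b : X n.+1), compat 0 x -> hiso (first_edge b) ->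
    (forall j, j <= n.+1 -> j != 0 -> p n (x j) = nface j b) ->
    exists y : Y n.+1,
      p _ y = b /\ forall j, j <= n.+1 -> j != 0 -> nface j y = x j.

(** The last face of the horn, with the base simplex, is the base of a lifting
    problem of one dimension less for the right fibration [Dec_compare p].  Its
    first edge is invertible since [DecPb_fst p] is conservative. *)
Lemma special_lift_step n :
  (forall Y X (p : smap Y X), right_fib p -> inner_kan X -> special_lift p n) ->
  forall Y X (p : smap Y X) (x : nat -> Y n.+1) (b : X n.+2),
    inner_fib p -> inner_kan X -> compat 0 x -> hiso (first_edge (x n.+2)) ->
    (forall j, j <= n.+2 -> j != 0 -> p _ (x j) = nface j b) ->
    exists y : Y n.+2,
      p _ y = b /\ forall j, j <= n.+2 -> j != 0 -> nface j y = x j.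
Proof.
move=> IH Y X p x b hp hX cx hx xb.
have hY := inner_fib_inner_kan hp hX.
have fib : right_fib (DecPb_fst p) by apply: DecPb_fst_right_fib.
have qR : inner_kan (DecPb p) by apply: (inner_fib_inner_kan (right_fib_inner_fib fib)).
have h : p _ (x n.+2, b).1 = nface n.+2 (x n.+2, b).2 by apply: xb.
pose z : DecPb p n.+1 := exist _ (x n.+2, b) h.
have [||j jn j0|y [yz hy]] := IH _ _ _ (Dec_compare_right_fib hp) qR (x : nat -> Dec Y n) z.
- case: n x b cx {hx xb h z IH} => [|n] //= x b cx i j ij jn i0 j0.
  by rewrite !dec_coface; [apply: cx => //; lia| lia | lia].
- refine (right_fib_conservative fib hY _).
  by rewrite -first_edge_map.
- apply: eq_exist => /=; rewrite dec_coface //; congr pair; last by apply: xb; lia.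
  by rewrite -[LHS]/(nface _ _) -(cx j n.+2) //; lia.
exists y; have /(congr1 sval)/= [y1 y2] := yz; split=> // j jn j0.
have [jn'|jn'] := leqP j n.+1; first by rewrite -nface_Dec // hy.
by have -> : j = n.+2 by lia.
Qed.

Lemma special_lift_right_fib n (Y X : sSet) (p : smap Y X) :
  right_fib p -> inner_kan X -> special_lift p n.
Proof.
elim: n Y X p => [|n IH] Y X p hp hX x b cx hb xb.
  have [||f fb fx] := @right_fib_lift_iso _ _ _ hp b (x 1).
  - by rewrite -[b]first_edge1.
  - by rewrite xb // srcE.
  by exists f; split=> // -[|[|j]] //; rewrite -fx srcE.
apply: special_lift_step => //; first exact: right_fib_inner_fib.
apply: (right_fib_conservative hp hX).
by rewrite -first_edge_map xb // first_edge_nface.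
Qed.

Lemma special_outer_lift n (Y X : sSet) (p : smap Y X) (x : nat -> Y n.+1) (b : X n.+2) :
    inner_fib p -> inner_kan X -> compat 0 x -> hiso (first_edge (x n.+2)) ->
    (forall j, j <= n.+2 -> j != 0 -> p _ (x j) = nface j b) ->
    exists y : Y n.+2,
      p _ y = b /\ forall j, j <= n.+2 -> j != 0 -> nface j y = x j.
Proof. by apply: special_lift_step => *; apply: special_lift_right_fib. Qed.

Lemma point_inner_kan : inner_kan point.
Proof. by move=> n k kn x [] _ _; exists tt; split=> // j _ _; case: (x j). Qed.

(** * Invertible arrows extend to the interval *)

(** A map from [J] is determined by the images of the simplices that alternate
    between the two vertices and start at the first one.  These images form a
    tower of simplices [v n] of dimension [n.+1], each the last face of the
    next, for which [act a (v n)] depends on [a] only through the parities of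
    its values. *)
Definition same_parity m n n' (a : dmap m n) (b : dmap m n') : Prop :=
  forall i, odd (a i) = odd (b i).

Definition alternating (X : sSet) n (v : X n) : Prop :=
  forall m (a b : dmap m n), same_parity a b -> act a v = act b v.

(** For [j > 0] the values of [collapse j] have the same parities as those of
    the coface [j], which is why the faces of the next alternating simplex are
    [act (collapse j) v]. *)
Definition collapsen (j i : nat) : nat := i - (j <= i).

Lemma collapsen_mono j a b : a <= b -> collapsen j a <= collapsen j b.
Proof. by rewrite /collapsen; lia. Qed.

Definition collapse (j n : nat) : dmap n n := dmap_nat n n (@collapsen_mono j).

Lemma collapseE j n i : collapse j n i = collapsen j i :> nat.
Proof. by rewrite dmap_natE /collapsen; have := ltn_ord i; lia. Qed.

(** If [a] takes all the positive values then it starts at 0 or 1, moves by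
    steps of at most one, and reaches [n]; comparing with [b] from the left and
    from the right, each step of [a] forces a step of [b]. *)
Lemma full_parity m n (a b : dmap m n) : same_parity a b ->
  (forall j, 0 < j <= n -> exists i, a i = j :> nat) -> a = b.
Proof.
move=> ab full.
have step (i i' : 'I_m.+1) : i' = i.+1 :> nat -> a i' <= (a i).+1.
  move=> ii'; rewrite leqNgt; apply/negP => lt.
  have [|l al] := full (a i).+1; first by have := ltn_ord (a i'); lia.
  have [li|li] := leqP l i; first by have := dmap_mono a li; lia.
  have /(dmap_mono a) : i' <= l by lia.
  by rewrite al; lia.
have start : a ord0 <= 1.
  rewrite leqNgt; apply/negP => lt.
  have [|l al] := full 1; first by have := ltn_ord (a ord0); lia.
  have /(dmap_mono a) : @ord0 m <= l by [].
  by rewrite al; lia.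
have stop : n <= a ord_max.
  have [n0|n0] := leqP n 0; first by lia.
  have [|l al] := full n; first by lia.
  by have /(dmap_mono a) : l <= @ord_max m; rewrite ?al // -ltnS.
apply: dmap_eq.
have lower k (km : k < m.+1) : a (Ordinal km) <= b (Ordinal km).
  elim: k km => [|k IH] km.
    have -> : Ordinal km = ord0 by apply: val_inj.
    by have := ab ord0; case: (a ord0 : nat) start => [|[|?]] //=; case: (b ord0 : nat).
  have km' : k < m.+1 by lia.
  have := IH km'; have := step (Ordinal km') (Ordinal km) erefl.
  have := ab (Ordinal km'); have := ab (Ordinal km).
  have /(dmap_mono b) : Ordinal km' <= Ordinal km by [].
  lia.
have upper k (km : m - k < m.+1) : b (Ordinal km) <= a (Ordinal km).
  elim: k km => [|k IH] km.
    have -> : Ordinal km = ord_max by apply: val_inj; rewrite /= subn0.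
    by apply: leq_trans stop; rewrite -ltnS.
  have km' : m - k < m.+1 by lia.
  have [mk|mk] := leqP m k.
    by have -> : Ordinal km = Ordinal km' by apply: val_inj => /=; lia.
  have e : Ordinal km' = (Ordinal km).+1 :> nat by rewrite /=; lia.
  have := IH km'; have := step _ _ e.
  have := ab (Ordinal km'); have := ab (Ordinal km).
  have /(dmap_mono b) : Ordinal km <= Ordinal km' by rewrite e.
  lia.
move=> i; apply/eqP; rewrite eqn_leq; apply/andP; split.
  by have := lower i (ltn_ord i); congr (_ <= _); congr (nat_of_ord (_ _)); apply: val_inj.
have im : m - (m - i) < m.+1 by lia.
have := upper _ im.
by congr (_ <= _); congr (nat_of_ord (_ _)); apply: val_inj => /=; have := ltn_ord i; lia.
Qed.

Lemma missing_parity m n (a b : dmap m n) : same_parity a b -> a <> b ->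
  exists2 j, 0 < j <= n & forall i, a i != j :> nat.
Proof.
move=> ab neq; apply: contrapT => nex; apply: neq; apply: (full_parity ab) => j jn.
apply: contrapT => na; apply: nex; exists j => // i.
by apply/eqP => ai; apply: na; exists i.
Qed.

(** The prescribed faces form a special outer horn.  Two maps of equal parities
    that differ both miss a positive vertex [j], so they factor through faces
    that are obtained from [v]. *)
Lemma alternating_step (X : sSet) n (v : X n.+1) : inner_kan X -> alternating v ->
  hiso (first_edge v) ->
  exists w : X n.+2, [/\ alternating w, nface n.+2 w = v & first_edge w = first_edge v].
Proof.
move=> hX av hv.
pose x j := act (collapse j n.+1) v.
have xlast : x n.+2 = v.
  rewrite -[RHS]act_id; apply: av => i; rewrite collapseE didE /collapsen.
  by have := ltn_ord i; lia.
have [|||w [_ hw]] := @special_outer_lift n X point (to_point X) x tt hX point_inner_kan.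
- move=> i j ij jn i0 j0; rewrite /nface /x !act_comp; apply: av => l.
  by rewrite !(dcompE, collapseE, cofaceE) /collapsen /bump; lia.
- by rewrite xlast.
- by [].
have miss m (a : dmap m n.+2) j : 0 < j <= n.+2 -> (forall i, a i != j :> nat) ->
    exists2 c : dmap m n.+1, same_parity c a & act a w = act c v.
  move=> jn aj; exists (dcomp (collapse j n.+1) (dcomp (codeg j n.+1) a)).
    move=> i; rewrite !(dcompE, collapseE, codegE) /collapsen /unbump.
    by have := aj i; have := ltn_ord (a i); lia.
  rewrite -act_comp -/(x j) -hw ?/nface ?act_comp; try lia.
  congr act; apply: dmap_eq => i; rewrite !(dcompE, cofaceE, codegE) /bump /unbump.
  by have := aj i; have := ltn_ord (a i); lia.
have dw : nface n.+2 w = v by rewrite hw.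
exists w; split=> //; last by rewrite -dw first_edge_nface.
move=> m a b ab; have [-> //|neq] := pselect (a = b).
have ba : same_parity b a by move=> i; rewrite ab.
have [j jn aj] := missing_parity ab neq.
have [j' jn' bj'] := missing_parity ba (nesym neq).
have [c ca ->] := miss _ a j jn aj; have [c' cb ->] := miss _ b j' jn' bj'.
by apply: av => i; rewrite ca cb ab.
Qed.

Lemma alternating_tower (X : sSet) (e : X 1) : inner_kan X -> hiso e ->
  exists v : forall n, X n.+1,
    [/\ v 0 = e, forall n, alternating (v n) & forall n, nface n.+2 (v n.+1) = v n].
Proof.
move=> hX he.
pose S n := {v : X n.+1 | alternating v /\ first_edge v = e}.
have step n (v : S n) : {w : S n.+1 | nface n.+2 (sval w) = sval v}.
  case: v => v [av ve]; apply: cid.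
  have [|w [aw dw we]] := alternating_step hX av; first by rewrite ve.
  by exists (exist _ w (conj aw (etrans we ve))).
have start : alternating e.
  move=> m a b ab; congr act; apply: dmap_eq => i.
  by have := ab i; have := ltn_ord (a i); have := ltn_ord (b i); lia.
pose v := fix v n : S n := match n with
  | 0 => exist _ e (conj start (first_edge1 e))
  | n'.+1 => sval (step n' (v n')) end.
exists (fun n => sval (v n)); split=> [//|n|n]; first by have [] := svalP (v n).
exact: (svalP (step n (v n))).
Qed.

(** Any sequence of vertices is the sequence of parities of a monotone one:
    [2 i + x i]. *)
Lemma weave_mono m (x : J m) i j : i <= j ->
  i.*2 + x (inord i) <= j.*2 + x (inord j).
Proof.
rewrite leq_eqVlt => /orP[/eqP-> //|ij].
by case: (x (inord i)); case: (x (inord j)); lia.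
Qed.

Definition weave m (x : J m) : dmap m m.*2.+1 := dmap_nat _ _ (weave_mono x).

Lemma weaveE m (x : J m) i : weave x i = i.*2 + x i :> nat.
Proof.
rewrite dmap_natE inord_val; have := ltn_ord i.
by case: (x i); lia.
Qed.

Theorem hiso_extends (X : sSet) (e : X 1) : inner_kan X -> hiso e ->
  exists h : smap J X,
    h 0 (J_vertex false 0) = src e /\ h 0 (J_vertex true 0) = tgt e.
Proof.
move=> hX he; have [v [v0 av dv]] := alternating_tower hX he.
have widen l n (a : dmap l n.+1) k : exists2 b : dmap l (k + n).+1,
    same_parity a b & act a (v n) = act b (v (k + n)).
  elim: k => [|k [b ab ->]]; first by exists a.
  exists (dcomp (coface (k + n).+2 _) b).
    move=> i; rewrite dcompE cofaceE /bump ab; have := ltn_ord (b i).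
    by case: leqP => // _; rewrite add0n.
  by rewrite -dv /nface act_comp.
(* Stages of the tower are compared inside a common later one. *)
have coh l n n' (a : dmap l n.+1) (b : dmap l n'.+1) :
    same_parity a b -> act a (v n) = act b (v n').
  move=> ab; have [a' aa' ->] := widen _ _ a n'; have [b' bb' ->] := widen _ _ b n.
  rewrite addnC in b' bb' *; apply: av => i.
  by rewrite -aa' -bb'.
have nat m l (a : dmap m l) (x : J l) :
    act (weave (act a x)) (v m.*2) = act a (act (weave x) (v l.*2)).
  rewrite act_comp; apply: coh => i.
  by rewrite dcompE !weaveE /= ffunE !oddD !odd_double.
exists (SMap nat); rewrite srcE tgtE /= v0 /nface; split; congr act; apply: dmap_eq => i.
  by rewrite weaveE cofaceE ffunE /bump (ord1 i).
by rewrite weaveE cofaceE ffunE /bump (ord1 i).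
Qed.

(** * Cotensors and evaluation *)

Lemma in_In (T : eqType) (x : T) s : x \in s -> List.In x s.
Proof.
elim: s => //= y s IH; rewrite inE => /orP[/eqP-> |/IH]; first by left.
by right.
Qed.

Lemma fin_presented_Delta n : fin_presented (Delta n).
Proof.
pose P m (F : {ffun 'I_m.+1 -> 'I_n.+1}) :=
  [forall i : 'I_m.+1, forall j : 'I_m.+1, (i <= j) ==> (F i <= F j)].
exists (List.flat_map (fun m => List.map
    (fun F : {F | P m F} => existT (Delta n) m (DMap (valP F))) (enum {: {F | P m F}}))
  (iota 0 n.+1)) => m a ndeg.
apply/List.in_flat_map; exists m; split; last first.
  apply/List.in_map_iff; exists (exist _ (dfun a) (dfunP a)); split.
    by congr existT; apply: dmapP.
  by apply/in_In; rewrite mem_enum.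
apply/in_In; rewrite mem_iota /= add0n ltnS leqNgt; apply/negP => lt.
by apply: ndeg; exists n, a, (did n); split=> //=; dmap_lia.
Qed.

Lemma dmap0_eq n (a b : dmap n 0) : a = b.
Proof. by apply: dmapP => i; rewrite [a i]ord1 [b i]ord1. Qed.

Lemma Delta_yoneda (X : sSet) n (f : smap (Delta n) X) k (u : Delta n k) :
  f k u = act u (f n (did n)).
Proof. by rewrite -sfunP; congr (f _ _); rewrite /=; dmap_lia. Qed.

Definition simplex_map (X : sSet) n (x : X n) : smap (Delta n) X.
Proof. by exists (fun k u => act u x) => l m a u; rewrite act_comp. Defined.

Lemma act_from0 (X : sSet) n (x : X 0) (a : dmap n 0) : act a x = const n x.
Proof. by congr act; apply: dmap0_eq. Qed.

Section Whiskers.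
Variable K : isoCat.
Implicit Types A B C X Y : K.

Definition pre_map X Y A (g : X ~> Y) : smap (hom Y A) (hom X A).
Proof.
by exists (fun n x => pre g x) => m n a x; rewrite /pre -kcomp_act act_const.
Defined.

Lemma post_map_inner_fib X E B (p : E ~> B) :
  qcat_isofib (post_map X p) -> inner_fib (post_map X p).
Proof. by case=> h _; apply: inner_horns_inner_fib. Qed.

Lemma post0 X A B (f : A ~> B) (x : X ~> A) : post f x = kcomp f x.
Proof. by rewrite /post const0. Qed.

Lemma pre0 X Y A (g : X ~> Y) (y : Y ~> A) : pre g y = kcomp y g.
Proof. by rewrite /pre const0. Qed.

Lemma post_post X A B C n (g : B ~> C) (f : A ~> B) (x : hom X A n) :
  post g (post f x) = post (kcomp g f) x.
Proof. by rewrite /post const_comp kcomp_assoc. Qed.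

Lemma pre_pre X Y Z A n (g : Y ~> Z) (f : X ~> Y) (z : hom Z A n) :
  pre f (pre g z) = pre (kcomp g f) z.
Proof. by rewrite /pre const_comp kcomp_assoc. Qed.

Lemma post_pre X Y A B n (f : A ~> B) (g : X ~> Y) (y : hom Y A n) :
  post f (pre g y) = pre g (post f y).
Proof. by rewrite /post /pre kcomp_assoc. Qed.

Lemma post_const X A B n (f : A ~> B) (x : X ~> A) :
  post f (const n x) = const n (kcomp f x).
Proof. by rewrite /post const_comp. Qed.

Lemma pre_const X Y A n (g : X ~> Y) (y : Y ~> A) :
  pre g (const n y) = const n (kcomp y g).
Proof. by rewrite /pre const_comp. Qed.

Lemma post_kcomp X Y A B n (f : A ~> B) (y : hom Y A n) (x : hom X Y n) :
  post f (kcomp y x) = kcomp (post f y) x.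
Proof. by rewrite /post kcomp_assoc. Qed.

Lemma kcomp_id0l A B (f : A ~> B) : kcomp (idf B) f = f.
Proof. by rewrite -[idf B]const0 kcomp_idl. Qed.

Lemma kcomp_id0r A B (f : A ~> B) : kcomp f (idf A) = f.
Proof. by rewrite -[idf A]const0 kcomp_idr. Qed.

Lemma post_act X A B (f : A ~> B) m n (a : dmap m n) (x : hom X A n) :
  post f (act a x) = act a (post f x).
Proof. exact: (sfunP (post_map X f)). Qed.

Lemma pre_act X Y A (f : X ~> Y) m n (a : dmap m n) (x : hom Y A n) :
  pre f (act a x) = act a (pre f x).
Proof. exact: (sfunP (pre_map A f)). Qed.

Lemma const_ct_cone A (T : cotensor (Delta 1) A) n e :
  const n (ct_cone T 0 (dconst 0 e)) = ct_cone T n (dconst n e).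
Proof. by rewrite /const -sfunP; congr (ct_cone T n _); rewrite /=; dmap_lia. Qed.

Definition id_cotensor A : cotensor (Delta 0) A.
Proof.
unshelve refine (@Cotensor K (Delta 0) A A _
  (fun X n g => g n (dconst n ord0 : Delta 0 n, did n : Delta n n)) _ _).
- by exists (fun n _ => const n (idf A)) => m n a u; rewrite act_const.
- move=> X n g k u a /=; rewrite kcomp_idl -sfunP; congr (g _ _).
  by congr pair; [apply: dmap0_eq | rewrite /=; dmap_lia].
- move=> X n x y h; have := h n (dconst n ord0) (did n).
  by rewrite /= !kcomp_idl !act_id.
Defined.

Definition terminal_cotensor (t : terminal K) (U : sSet) : cotensor U (one t).
Proof.
unshelve refine (@Cotensor K U (one t) (one t) _ (fun X n _ => bang t X n) _ _).
- by exists (fun n _ => bang t _ n) => *; apply: bang_uniq.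
- by move=> *; apply: bang_uniq.
- by move=> *; apply: bang_uniq.
Defined.

Definition terminal_pullback (t : terminal K) A (f : one t ~> one t) (g : A ~> one t) :
  pullback f g.
Proof.
unshelve refine (@Pullback K _ _ _ f g A (bang t A 0) (idf A) _ (fun X n a e h => e) _ _ _).
- exact: bang_uniq.
- by move=> *; apply: bang_uniq.
- by move=> X n a e h; rewrite /post kcomp_idl.
- by move=> X n x y _; rewrite /post !kcomp_idl.
Defined.

Definition vertex (e : 'I_2) : smap (Delta 0) (Delta 1).
Proof. by exists (fun n _ => dconst n e) => m n a u /=; dmap_lia. Defined.

Lemma vertex_mono e : smono (vertex e).
Proof. by move=> n u v _; apply: dmap0_eq. Qed.

Lemma ct_restr_vertex e A (T : cotensor (Delta 1) A) :
  ct_restr (vertex e) T (id_cotensor A) = ct_cone T 0 (dconst 0 e).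
Proof. by []. Qed.

Lemma ct_post_id E B (p : E ~> B) : ct_post p (id_cotensor E) (id_cotensor B) = p.
Proof. by rewrite /ct_post /ct_arr /= post_const const0 kcomp_id0r. Qed.

(** The cotensor of [p : E -> B] by the arrow in the slice over [B]: the object of
    arrows of [E] whose image in [B] is degenerate. *)
Record fibre_arrows E B (p : E ~> B) := FibreArrows {
  fa :> K;
  fa_src : fa ~> E;
  fa_cell : hom fa E 1;
  fa_isofib : isofib fa_src;
  fa_srcE : src fa_cell = fa_src;
  fa_over : post p fa_cell = const 1 (kcomp p fa_src);
  fa_ind : forall X n (G : smap (sprod (Delta 1) (Delta n)) (hom X E)) (b : hom X B n),
    (forall k (u : Delta 1 k) (a : Delta n k), post p (G k (u, a)) = act a b) ->
    exists x : hom X fa n, forall k (u : Delta 1 k) (a : Delta n k),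
      kcomp (act u fa_cell) (act a x) = G k (u, a);
  fa_uniq : forall X n (x y : hom X fa n),
    (forall k (u : Delta 1 k) (a : Delta n k),
      kcomp (act u fa_cell) (act a x) = kcomp (act u fa_cell) (act a y)) -> x = y }.
End Whiskers.

Section CosmosLimits.
Variable K : cosmos.
Implicit Types A B C E X Y : K.

(** The Leibniz map of the vertex 1 and of [B -> 1], with the terminal object as
    its own cotensors and [B] as the pullback. *)
Lemma isofib_ev1 B (T : cotensor (Delta 1) B) : isofib (ev T ord_max).
Proof.
have fp := fin_presented_Delta.
pose one_cot U := terminal_cotensor (cosmos_terminal K) U.
exact: (isofib_leibniz (TUE := id_cotensor B) (TVB := one_cot _) (TUB := one_cot _)
  (vertex_mono (e := ord_max)) (fp 0) (fp 1) (isofib_bang B) T (terminal_pullback _ _)).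
Qed.

(** The Leibniz map [L] of the vertex 0 and of [p] sends an arrow of [E] to its
    image in [B] and its source; pulling [L] back along the map that pairs [e]
    with the degenerate arrow at [p e] selects the arrows over identities, and
    makes the source an isofibration. *)
Lemma fibre_arrows_exist E B (p : E ~> B) : isofib p -> inhabited (fibre_arrows p).
Proof.
move=> hp.
have fp := fin_presented_Delta.
pose TE := cosmos_cotensor (fp 1) E; pose TB := cosmos_cotensor (fp 1) B.
have hp' : isofib (ct_post p (id_cotensor E) (id_cotensor B)) by rewrite ct_post_id.
pose P := cosmos_pullback (ct_restr (vertex ord0) TB (id_cotensor B)) hp'.
pose L := leibniz TE P.
have hL : isofib L by apply: isofib_leibniz => //; apply: vertex_mono.
have L1 : kcomp (pb1 P) L = ct_post p TE TB by rewrite -post0; apply: pb_ind1.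
have L2 : kcomp (pb2 P) L = ct_restr (vertex ord0) TE (id_cotensor E).
  by rewrite -post0; apply: pb_ind2.
have cst_nat m n (a : dmap m n) (u : Delta 1 n) : const m p = act a (const n p).
  by rewrite act_const.
pose cst : E ~> TB := ct_arr TB (SMap cst_nat).
have cst_sq : post (ct_restr (vertex ord0) TB (id_cotensor B)) cst
    = post (ct_post p (id_cotensor E) (id_cotensor B)) (idf E).
  rewrite !post0 ct_post_id kcomp_id0r ct_restr_vertex -[cst]const0.
  by rewrite /cst ct_arrE /= const0.
pose s : E ~> P := pb_ind P cst_sq.
have s1 : kcomp (pb1 P) s = cst by rewrite -post0; apply: pb_ind1.
have s2 : kcomp (pb2 P) s = idf E by rewrite -post0; apply: pb_ind2.
pose W := cosmos_pullback s hL.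
have WL := pb_sq W.
have src0 : kcomp (ct_cone TE 0 (dconst 0 ord0)) (pb2 W) = pb1 W.
  by rewrite -ct_restr_vertex -L2 -kcomp_assoc -WL kcomp_assoc s2 kcomp_id0l.
have coneE X n (x : hom X W n) k (u : Delta 1 k) (a : Delta n k) :
    kcomp (act u (pre (pb2 W) (ct_cone TE 1 (did 1)))) (act a x)
    = kcomp (ct_cone TE k u) (act a (post (pb2 W) x)).
  rewrite [in RHS]Delta_yoneda /pre -kcomp_act act_const -kcomp_assoc.
  by rewrite /post -kcomp_act act_const.
have post_p X n (x : hom X TE n) k (u : Delta 1 k) (a : Delta n k) :
    kcomp (ct_cone TB k u) (act a (post (kcomp (pb1 P) L) x))
    = post p (kcomp (ct_cone TE k u) (act a x)).
  rewrite L1 -post_act {1}/post kcomp_assoc /ct_post ct_arrE /=.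
  by rewrite /post kcomp_assoc.
constructor.
apply: (@FibreArrows K E B p W (pb1 W) (pre (pb2 W) (ct_cone TE 1 (did 1)))).
- exact: isofib_pb.
- rewrite srcE /nface -pre_act -Delta_yoneda pre0 -src0; congr (kcomp (ct_cone TE 0 _) _).
  by dmap_lia.
- have := post_p _ _ (pb2 W) _ (did 1) (dconst 1 ord0).
  rewrite !act_from0 -/(pre (pb2 W) (ct_cone TE 1 (did 1))) => <-.
  rewrite post0 -kcomp_assoc -WL kcomp_assoc s1 const_comp kcomp_assoc.
  by rewrite /cst ct_arrE /= const_comp.
- move=> X n G b hG.
  pose e : hom X E n := G n (dconst n ord0 : Delta 1 n, did n : Delta n n).
  have sq : post s e = post L (ct_ind TE G).
    apply: (@pb_uniq _ _ _ _ _ _ P).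
    + rewrite !post_post s1; apply: ct_uniq => k u a.
      rewrite post_p ct_indE hG -post_act {1}/post kcomp_assoc /cst ct_arrE /=.
      by rewrite -[LHS]/(post p _) -sfunP hG /=; congr act; rewrite /=; dmap_lia.
    + rewrite !post_post s2 L2 ct_restr_vertex /post kcomp_idl const_ct_cone.
      by rewrite -[ct_ind TE G]act_id ct_indE.
  exists (pb_ind W sq) => k u a.
  by rewrite coneE pb_ind2 ct_indE.
- move=> X n x y h; apply: (@pb_uniq _ _ _ _ _ _ W).
    have := h n (dconst n ord0) (did n).
    by rewrite !coneE -const_ct_cone !act_id !/(post _ (post _ _)) -src0 /post const_comp
      -!kcomp_assoc.
  by apply: ct_uniq => k u a; rewrite -!coneE.
Qed.
End CosmosLimits.

(** * Homotopies over a base *)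

Lemma sval_inj (A : Type) (P : A -> Prop) (u v : {x | P x}) : sval u = sval v -> u = v.
Proof. by case: u v => [x hx] [y hy] /= e; apply: eq_exist. Qed.

Section Over.
Variables (K : cosmos) (S E : K) (q : E ~> S) (hq : isofib q).

(** The homotopy is a triangle in the base whose other two edges are degenerate;
    lifting it along [q] replaces [g] by an arrow in the fibre. *)
Lemma strict_over X (d : X ~> S) (g : hom X E 1) : htpy (post q g) (const 1 d) ->
  exists th : map_over d hq 1, sval (src th) = src g /\ sval (tgt th) = tgt g.
Proof.
move=> h; have e := htpy_tgt h; rewrite tgt_const in e.
have /htriE[s [s2 s0 s1]] := h.
have fib : inner_fib (post_map X q) := post_map_inner_fib (isofib_hom X hq).
have [//|||y [ys hy]] :=
    fib 1 1 _ (fun j => if j is 0 then const 1 (tgt g) else g) s.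
- by move=> [|[|[|i]]] [|[|[|j]]] //= _ _ _ _; rewrite nface_const const0 tgtE.
- move=> [|[|[|j]]] //= _ _; rewrite ?s2 // s0 post_const; congr const.
  by rewrite -post0 !tgtE /nface post_act.
have yd : post q (nface 1 y) = const 1 d by rewrite /nface post_act [post q y]ys -s1.
exists (exist _ (nface 1 y) yd); rewrite !srcE !tgtE; split.
  by rewrite -[LHS]/(nface 1 (nface 1 y)) -(@nface_nface _ 1 1) // hy // srcE.
by rewrite -[LHS]/(nface 0 (nface 1 y)) (@nface_nface _ 0 0) // hy // tgtE nface_const const0.
Qed.

Hypothesis gE : groupoidal (SliceObj hq : slice S).

(** Groupoidality concerns domains that are isofibrations over [S].  The generic
    arrow of the fibres of [q] lives on such a domain, and every other one is a
    restriction of it. *)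
Lemma over_iso X (d : X ~> S) (th : map_over d hq 1) : hiso th.
Proof.
have [F] := fibre_arrows_exist hq.
pose FS : slice S := SliceObj (isofib_comp hq (fa_isofib F)).
pose om : hom FS (SliceObj hq : slice S) 1 := exist _ (fa_cell F) (fa_over F).
have nat m n (a : dmap m n) (ua : sprod (Delta 1) (Delta 0) n) :
  act (act a ua).1 (sval th) = act a (act ua.1 (sval th)) by rewrite act_comp.
have [|x hx] := @fa_ind _ _ _ _ F X 0 (SMap nat) d.
  by move=> k u a /=; rewrite post_act [post q _](svalP th) act_const act_from0.
have xth : pre x (fa_cell F) = sval th.
  have := hx 1 (did 1) (dconst 1 ord0).
  by rewrite /= act_from0 !act_id.
have xd : kcomp (kcomp q (fa_src F)) x = d.
  rewrite -kcomp_assoc -[kcomp (fa_src F) x]pre0 -fa_srcE srcE /nface pre_act xth.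
  rewrite -post0 post_act.
  by rewrite [post q _](svalP th) act_const const0.
rewrite (_ : th = precomp_over hq xd 1 om);
  first exact: (hiso_map (precomp_over hq xd) (gE om)).
exact/sval_inj/esym.
Qed.

(** A homotopy that is natural in the simplices of [M] comes from a single arrow
    [g] on a universal object [Z], restricted along the family [sigma]. *)
Lemma fibre_homotopy (Z X : K) (dz : Z ~> S) (c : X ~> S) (M : sSet)
    (sigma : smap M (hom X Z)) (g : hom Z E 1) :
  htpy (post q g) (const 1 dz) ->
  (forall n m, post dz (sigma n m) = const n c) ->
  exists h : smap (sprod M J) (map_over c hq), forall n m,
    sval (h n (m, J_vertex false n)) = post (src g) (sigma n m) /\
    sval (h n (m, J_vertex true n)) = post (tgt g) (sigma n m).
Proof.
move=> hg hs; have [th [<- <-]] := strict_over hg.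
have [H [H0 H1]] := hiso_extends (@qcat_inner_kan _) (over_iso th).
have over n (mj : sprod M J n) :
    post q (kcomp (sval (H n mj.2)) (sigma n mj.1)) = const n c.
  by rewrite post_kcomp [post q _](svalP (H n mj.2)) -(hs n mj.1).
pose h n mj : map_over c hq n := exist _ _ (over n mj).
have nat m n (a : dmap m n) mj : h m (act a mj) = act a (h n mj).
  by apply: sval_inj; rewrite /= !sfunP -kcomp_act.
have vert b n : H n (J_vertex b n) = const n (H 0 (J_vertex b 0)).
  by rewrite -sfun_const; congr (H n _); apply/ffunP => i; rewrite !ffunE.
exists (@SMap (sprod M J) (map_over c hq) h nat) => n m /=.
by rewrite (vert false n) (vert true n) H0 H1.
Qed.
End Over.

(** * Pairing and whiskering of arrows *)

Section Pairing.
Variables (K : cosmos) (A B : K).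

Definition kpairn X n (a : hom X A n) (b : hom X B n) : hom X (kprod A B) n :=
  pb_ind (kprod A B) (bang_uniq (post (bang (cosmos_terminal K) A 0) a)
                                (post (bang _ B 0) b)).

Lemma post_fst_pairn X n (a : hom X A n) (b : hom X B n) :
  post (kfst A B) (kpairn a b) = a.
Proof. exact: pb_ind1. Qed.

Lemma post_snd_pairn X n (a : hom X A n) (b : hom X B n) :
  post (ksnd A B) (kpairn a b) = b.
Proof. exact: pb_ind2. Qed.

Lemma prodn_uniq X n (x y : hom X (kprod A B) n) :
  post (kfst A B) x = post (kfst A B) y -> post (ksnd A B) x = post (ksnd A B) y ->
  x = y.
Proof. exact: pb_uniq. Qed.
End Pairing.

Section PostPre.
Variable K : isoCat.
Implicit Types X Y A B : K.
Lemma src_post X A B (g : A ~> B) (x : hom X A 1) : src (post g x) = kcomp g (src x).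
Proof. by rewrite -post0; apply: (src_map (post_map X g)). Qed.

Lemma tgt_post X A B (g : A ~> B) (x : hom X A 1) : tgt (post g x) = kcomp g (tgt x).
Proof. by rewrite -post0; apply: (tgt_map (post_map X g)). Qed.

Lemma src_pre X Y A (g : X ~> Y) (y : hom Y A 1) : src (pre g y) = kcomp (src y) g.
Proof. by rewrite -pre0; apply: (src_map (pre_map A g)). Qed.

Lemma tgt_pre X Y A (g : X ~> Y) (y : hom Y A 1) : tgt (pre g y) = kcomp (tgt y) g.
Proof. by rewrite -pre0; apply: (tgt_map (pre_map A g)). Qed.

End PostPre.

Section Generic.
Variable K : cosmos.

Lemma gen_src (B : K) (T : cotensor (Delta 1) B) : src (ct_cone T 1 (did 1)) = ev T ord0.
Proof.
rewrite srcE /nface -sfunP /ev; congr (ct_cone T 0 _).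
by rewrite /=; dmap_lia.
Qed.

Lemma gen_tgt (B : K) (T : cotensor (Delta 1) B) : tgt (ct_cone T 1 (did 1)) = ev T ord_max.
Proof.
rewrite tgtE /nface -sfunP /ev; congr (ct_cone T 0 _).
by rewrite /=; dmap_lia.
Qed.
End Generic.

(** * Cartesian transport along the arrows of the base *)

Section CartesianLift.
Variables (K : cosmos) (A B : K) (E : module A B) (T : cotensor (Delta 1) B).

Let q : E ~> kprod A B := mod_fib E.
Let qA : E ~> A := kcomp (kfst A B) q.
Let qB : E ~> B := kcomp (ksnd A B) q.
Let hqA : isofib qA := isofib_comp (isofib_fst A B) (mod_isofib E).

(** The comma object of [qB], formed as a pullback of the target map alone: the
    projection to [E] is then an isofibration, so the comma object lives in the
    slice over [A]. *)
Definition comma_mod : pullback qB (ev T ord_max) := cosmos_pullback qB (isofib_ev1 T).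
Let D := comma_mod.

Definition comma_mod_cell : hom D (kprod A B) 1 :=
  kpairn (const 1 (kcomp qA (pb1 D))) (pre (pb2 D) (ct_cone T 1 (did 1))).

Lemma isofib_comma_mod : isofib (pb1 D).
Proof. exact/isofib_pb/isofib_ev1. Qed.

Definition map_over_forget (S X F : K) (b : X ~> S) (p : F ~> S) (hp : isofib p) :
  smap (map_over b hp) (hom X F).
Proof. by exists (fun n x => sval x). Defined.

(** This unfolds cartesianness of [q] in the slice over [A] for the generic arrow
    of [comma_mod].  A cell [om] whose image is a restriction of that arrow has
    the same image as the restricted lift, so the factorisation lies over a
    degenerate arrow. *)
Lemma cartesian_lift : exists (r : D ~> E) (chi : hom D E 1),
  [/\ arr r (pb1 D) chi,
      kcomp q r = kpair (kcomp qA (pb1 D)) (kcomp (ev T ord0) (pb2 D)),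
      htpy (post q chi) comma_mod_cell &
      forall X (k : X ~> D) (e : X ~> E) (om : hom X E 1),
        isofib (kcomp qA e) -> arr e (kcomp (pb1 D) k) om ->
        post q om = pre k comma_mod_cell ->
        exists g : hom X E 1, arr e (kcomp r k) g /\
          htpy (post q g) (const 1 (kcomp q e))].
Proof.
have [_ lift stable] := mod_cartesian E.
pose EA : slice A := SliceObj hqA.
pose SA : slice A := SliceObj (isofib_fst A B).
pose DA : slice A := SliceObj (isofib_comp hqA isofib_comma_mod).
have pb1_over : post qA (pb1 D) = const 0 (slice_fib DA) by rewrite post0 const0.
pose e1 : DA ~> EA := exist _ (pb1 D) pb1_over.
have al_over : post (kfst A B) comma_mod_cell = const 1 (slice_fib DA).
  exact: post_fst_pairn.
pose al : hom DA SA 1 := exist _ comma_mod_cell al_over.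
have cell_src : src comma_mod_cell = kpair (kcomp qA (pb1 D)) (kcomp (ev T ord0) (pb2 D)).
  apply: prod_uniq; rewrite ?fst_pair ?snd_pair -src_post.
    by rewrite post_fst_pairn src_const.
  by rewrite post_snd_pairn src_pre gen_src.
have cell_tgt : tgt comma_mod_cell = kcomp q (pb1 D).
  apply: prod_uniq; rewrite -tgt_post kcomp_assoc.
    by rewrite post_fst_pairn tgt_const.
  by rewrite post_snd_pairn tgt_pre gen_tgt; apply/esym/(pb_sq D).
have arr_al : arr (src al) (post (slice_map (isofib_fst A B) (mod_isofib E)) e1) al.
  by split=> //; apply: sval_inj; rewrite [RHS]post0; apply: cell_tgt.
have [e' [chi [cart b_e' chi_al]]] := lift DA e1 _ al arr_al.
exists (sval e'), (sval chi).
have [[chi_src chi_tgt] _ _] := cart.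
have qr : kcomp q (sval e') = kpair (kcomp qA (pb1 D)) (kcomp (ev T ord0) (pb2 D)).
  by rewrite -cell_src -post0; apply: (congr1 sval b_e').
split=> //.
- by split; [exact: (congr1 sval chi_src) | exact: (congr1 sval chi_tgt)].
- exact: (htpy_map (map_over_forget _ _) chi_al).
move=> X k e om hX [om_src om_tgt] om_cell.
have om_over : post qA om = const 1 (kcomp qA (kcomp (pb1 D) k)).
  by rewrite -post_post om_cell post_pre post_fst_pairn pre_const kcomp_assoc.
have ke : kcomp qA (kcomp (pb1 D) k) = kcomp qA e.
  by rewrite -om_src -src_post om_over src_const.
pose XA : slice A := SliceObj hX.
have k_over : post (slice_fib DA) k = const 0 (slice_fib XA).
  by rewrite post0 const0 /= -kcomp_assoc ke.
pose k' : XA ~> DA := exist _ k k_over.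
have e_over : post qA e = const 0 (slice_fib XA) by rewrite post0 const0.
pose e2 : XA ~> EA := exist _ e e_over.
pose om' : hom XA EA 1 := exist _ om (etrans om_over (congr1 (const 1) ke)).
have [_ factor _] := stable _ _ k' _ _ _ cart.
set p := slice_map _ _ in cart chi_al b_e' factor arr_al.
have cell_htpy : htpy (post p (pre k' chi)) (post p om').
  rewrite post_pre (_ : post p om' = pre k' al); last exact: sval_inj.
  exact: (htpy_map (pre_map _ k') chi_al).
(* The restricted lift and [om] have the same source in the base, so [factor]
   applies to a degenerate arrow. *)
have pe : post p (pre k' e') = post p e2.
  apply: sval_inj; change (post q (pre k (sval e')) = post q e).
  by rewrite !post0 pre0 kcomp_assoc qr -cell_src -src_pre -om_cell src_post om_src.
have om'_arr : arr e2 (pre k' e1) om'.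
  split; apply: sval_inj; first exact: om_src.
  by rewrite [RHS]pre0; apply: om_tgt.
have [||g [[gs gt] gover _]] := factor e2 om' (const 1 (post p e2)) om'_arr.
- by rewrite pe; split; rewrite ?src_const ?tgt_const.
- have := htpy_idl (@qcat_inner_kan _) cell_htpy.
  suff -> : src (post p (pre k' chi)) = post p e2 by [].
  by rewrite src_post src_pre chi_src -pe post0 pre0.
exists (sval g); split.
  split; first exact: (congr1 sval gs).
  by apply: (etrans (congr1 sval gt)); apply: (pre0 k (sval e')).
rewrite -(post0 q e).
exact: (htpy_map (map_over_forget _ _) gover).
Qed.
End CartesianLift.

(** * The unit of the comma object *)

(** An n-simplex [(u, a)] of the square is a chain in a product of two chains, so
    it lies in the triangle [u <= a] or in the triangle [a <= u]; in both cases
    [u + a] is its position there. *)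
Lemma square (X : sSet) (s1 s2 : X 2) : nface 1 s1 = nface 1 s2 ->
  exists Q : smap (sprod (Delta 1) (Delta 1)) X,
    [/\ forall k (a : Delta 1 k), Q k (dconst k ord0, a) = act a (nface 2 s1),
        forall k (a : Delta 1 k), Q k (dconst k ord_max, a) = act a (nface 0 s2),
        forall k (u : Delta 1 k), Q k (u, dconst k ord0) = act u (nface 2 s2) &
        forall k (u : Delta 1 k), Q k (u, dconst k ord_max) = act u (nface 0 s1)].
Proof.
move=> diag.
have sum_mono k (u a : dmap k 1) i j : i <= j ->
    u (inord (minn k i)) + a (inord (minn k i)) <= u (inord (minn k j)) + a (inord (minn k j)).
  move=> ij; apply: leq_add; apply: dmap_mono; rewrite !inordK; lia.
pose sum k u a : dmap k 2 := dmap_nat k 2 (@sum_mono k u a).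
have sumE k u a i : sum k u a i = u i + a i :> nat.
  rewrite dmap_natE; have -> : inord (minn k i) = i.
    by apply: val_inj; rewrite /= inordK; have := ltn_ord i; lia.
  by have := ltn_ord (u i); have := ltn_ord (a i); lia.
pose lower k (u a : dmap k 1) := [forall i, u i <= a i].
pose Qf k (ua : sprod (Delta 1) (Delta 1) k) :=
  act (sum k ua.1 ua.2) (if lower k ua.1 ua.2 then s1 else s2).
have comparable k (u a : dmap k 1) : ~~ lower k u a -> forall i, a i <= u i.
  rewrite negb_forall => /existsP[j]; rewrite -ltnNge => lt i.
  have [ij|ji] := leqP i j.
    by have := dmap_mono a ij; have := ltn_ord (u j); lia.
  by have := dmap_mono u (ltnW ji); have := ltn_ord (a i); have := ltn_ord (u j); lia.
(* Where [u] and [a] agree the simplex lies on the common diagonal. *)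
have Qeq k (u a : dmap k 1) : (forall i, a i = u i) ->
    act (sum k u a) s1 = act (sum k u a) s2.
  move=> au; have -> : sum k u a = dcomp (coface 1 1) u.
    by apply: dmap_eq => i; rewrite sumE dcompE cofaceE au /bump; have := ltn_ord (u i); lia.
  by rewrite -!act_comp -!/(nface 1 _) diag.
have nat m n (al : dmap m n) (ua : sprod (Delta 1) (Delta 1) n) :
    Qf m (act al ua) = act al (Qf n ua).
  case: ua => u a; rewrite /Qf act_comp /=.
  have -> : sum m (dcomp u al) (dcomp a al) = dcomp (sum n u a) al.
    by apply: dmap_eq => i; rewrite !(sumE, dcompE).
  case: ifP => l1; case: ifP => l2 //; last first.
    by move: l1; move/forallP: l2 => l2 /negP[]; apply/forallP => i; rewrite !dcompE.
  have -> : dcomp (sum n u a) al = sum m (dcomp u al) (dcomp a al).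
    by apply: dmap_eq => i; rewrite !(sumE, dcompE).
  apply: Qeq => i; apply: val_inj; apply/eqP; rewrite eqn_leq !dcompE /=.
  move/forallP: l1 => /(_ i); rewrite !dcompE => ->.
  by rewrite andbT (comparable _ _ _ (negbT l2)).
exists (SMap nat); split=> k a /=; rewrite /Qf /=.
- have -> : lower k (dconst k ord0) a by apply/forallP => i; rewrite dconstE.
  by rewrite /nface act_comp; congr act; apply: dmap_eq => i;
    rewrite sumE dcompE cofaceE dconstE /bump; have := ltn_ord (a i); rewrite /=; lia.
- rewrite (_ : act _ _ = act (sum k (dconst k ord_max) a) s2); last first.
    case: ifP => // /forallP l; apply: Qeq => i; apply: val_inj.
    by have := l i; have := ltn_ord (a i); rewrite !dconstE /=; lia.
  by rewrite /nface act_comp; congr act; apply: dmap_eq => i;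
    rewrite sumE dcompE cofaceE dconstE /bump; have := ltn_ord (a i); rewrite /=; lia.
- rewrite (_ : act _ _ = act (sum k a (dconst k ord0)) s2); last first.
    case: ifP => // /forallP l; apply: Qeq => i; apply: val_inj.
    by have := l i; rewrite !dconstE /=; lia.
  by rewrite /nface act_comp; congr act; apply: dmap_eq => i;
    rewrite sumE dcompE cofaceE dconstE /bump; have := ltn_ord (a i); rewrite /=; lia.
- have -> : lower k a (dconst k ord_max).
    by apply/forallP => i; rewrite dconstE /= -ltnS.
  by rewrite /nface act_comp; congr act; apply: dmap_eq => i;
    rewrite sumE dcompE cofaceE dconstE /bump; have := ltn_ord (a i); rewrite /=; lia.
Qed.

Section Comma.
Variables (K : cosmos) (A B : K) (f : A ~> B) (T : cotensor (Delta 1) B).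
Variable (C : comma T f).

Lemma comma_ev1 : kcomp (ev T ord_max) (pb2 C) = kcomp f (comma1 C).
Proof.
have e := congr1 (kcomp (kfst B B)) (pb_sq C).
by rewrite !kcomp_assoc !fst_pair in e; rewrite /comma1 kcomp_assoc.
Qed.

Lemma comma_ev0 : kcomp (ev T ord0) (pb2 C) = comma0 C.
Proof.
have e := congr1 (kcomp (ksnd B B)) (pb_sq C).
by rewrite !kcomp_assoc !snd_pair in e; rewrite /comma0.
Qed.

Lemma kcomp_ct_cone n (u : Delta 1 n) :
  kcomp (ct_cone T n u) (const n (pb2 C)) = act u (comma_cell C).
Proof. by rewrite Delta_yoneda -pre_act. Qed.

Variables (t : A ~> C) (t1 : kcomp (comma1 C) t = idf A).
Variable (t0 : kcomp (comma0 C) t = f).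
Variable (tphi : htpy (pre t (comma_cell C)) (const 1 f)).

(** An arrow in [C] is a square in [B] together with an arrow in [A].  The square
    of [eta] has [phi] as its left and bottom sides, an identity on top, and
    [phi t p1] on the right; it commutes because [phi t] is homotopic to an
    identity.  The two components are prescribed strictly, not up to homotopy:
    [x eta] then lies over identities of [A], and transporting [x t p1] along its
    image in [B] is the chosen inverse on the nose. *)
Lemma comma_unit : exists eta : hom C C 1,
  [/\ src eta = idf C, tgt eta = kcomp t (comma1 C),
      post (comma1 C) eta = const 1 (comma1 C) &
      post (comma0 C) eta = comma_cell C].
Proof.
have [phi0 phi1] := comma_cellP C; set phi := comma_cell C in phi0 phi1 *.
pose psi := pre (kcomp t (comma1 C)) phi.
have qB : inner_kan (hom C B) := @qcat_inner_kan _.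
have psi_const : htpy psi (const 1 (kcomp f (comma1 C))).
  by have := htpy_map (pre_map B (comma1 C)) tphi; rewrite /= pre_pre pre_const.
have /htriE[s1 [s12 s10 s11]] : htri phi psi phi.
  have idr := htri_idr phi; rewrite phi1 in idr.
  have := htpy_sym qB psi_const; rewrite /htpy tgt_const => psi'.
  exact: (htri_fill2 qB idr psi' idr).
have /htriE[s2 [s22 s20 s21]] := htri_idr phi.
have [|Q [Q0 Q1 Q2 Q3]] := @square _ s1 s2; first by rewrite s11 s21.
pose x : hom C T 1 := ct_ind T Q.
have xE k (u : Delta 1 k) (a : Delta 1 k) : kcomp (ct_cone T k u) (act a x) = Q k (u, a).
  exact: ct_indE.
have ev_x e : post (ev T e) x = Q 1 (dconst 1 e, did 1).
  by rewrite /post const_ct_cone -[x]act_id xE.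
have sq : post (kpair (kcomp f (kfst A B)) (ksnd A B)) (kpairn (const 1 (comma1 C)) phi)
    = post (ev10 T) x.
  apply: prodn_uniq; rewrite !post_post ?fst_pair ?snd_pair.
    rewrite -post_post post_fst_pairn post_const ev_x Q1 s20 act_id phi1 //.
  by rewrite post_snd_pairn ev_x Q0 s12 act_id.
pose eta : hom C C 1 := pb_ind C sq.
have eta1 : post (pb1 C) eta = kpairn (const 1 (comma1 C)) phi by apply: pb_ind1.
have eta2 : post (pb2 C) eta = x by apply: pb_ind2.
have vert k (u : Delta 1 k) (a : Delta 0 k) (b : Delta 1 0) :
    kcomp (ct_cone T k u) (act a (act b x)) = Q k (u, dconst k (b ord0)).
  rewrite act_comp xE; congr (Q k (_, _)).
  by apply: dmap_eq => i; rewrite dcompE dconstE; congr (nat_of_ord (b _)); apply: ord1.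
have v1 : coface 1 0 ord0 = ord0 :> 'I_2 by apply: val_inj; rewrite /= cofaceE.
have v0 : coface 0 0 ord0 = ord_max :> 'I_2 by apply: val_inj; rewrite /= cofaceE.
exists eta; split.
- apply: (@pb_uniq _ _ _ _ _ _ C); rewrite !post0 -?src_post kcomp_id0r.
    rewrite eta1; apply: prod_uniq; rewrite -src_post.
      by rewrite post_fst_pairn src_const.
    by rewrite post_snd_pairn phi0.
  rewrite eta2; apply: ct_uniq => k u a.
  by rewrite srcE /nface vert act_from0 kcomp_ct_cone v1 Q2 s22.
- apply: (@pb_uniq _ _ _ _ _ _ C); rewrite !post0 -?tgt_post.
    rewrite eta1; apply: prod_uniq; rewrite -tgt_post.
      by rewrite post_fst_pairn tgt_const 2!kcomp_assoc t1 kcomp_id0l.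
    by rewrite post_snd_pairn phi1 2!kcomp_assoc [kcomp (kcomp _ _) t]t0.
  rewrite eta2; apply: ct_uniq => k u a.
  rewrite tgtE /nface vert act_from0 v0 Q3 s10 const_comp kcomp_assoc kcomp_ct_cone.
  by rewrite /psi -pre_act.
- by rewrite /comma1 -post_post eta1 post_fst_pairn.
- by rewrite /comma0 -post_post eta1 post_snd_pairn.
Qed.
End Comma.

(** * The equivalence *)

Lemma htri_pairn (K : cosmos) (A B X : K) (x y z : hom X (kprod A B) 1) :
  htri (post (kfst A B) x) (post (kfst A B) y) (post (kfst A B) z) ->
  htri (post (ksnd A B) x) (post (ksnd A B) y) (post (ksnd A B) z) ->
  htri x y z.
Proof.
move=> /htriE[s [s2 s0 s1]] /htriE[s' [s2' s0' s1']].
apply/htriE; exists (kpairn s s').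
by split; apply: prodn_uniq;
  rewrite /nface post_act ?post_fst_pairn ?post_snd_pairn // -/(nface _ _).
Qed.

Lemma htpy_pairn (K : cosmos) (A B X : K) (x y : hom X (kprod A B) 1) :
  htpy (post (kfst A B) x) (post (kfst A B) y) ->
  htpy (post (ksnd A B) x) (post (ksnd A B) y) -> htpy x y.
Proof.
by move=> h1 h2; apply: htri_pairn; rewrite post_const -tgt_post.
Qed.

Lemma const_src (X : sSet) n (e : X 1) : const n (src e) = act (dconst n ord0) e.
Proof. by rewrite srcE /nface /const act_comp; congr act; dmap_lia. Qed.

Lemma const_tgt (X : sSet) n (e : X 1) : const n (tgt e) = act (dconst n ord_max) e.
Proof. by rewrite tgtE /nface /const act_comp; congr act; dmap_lia. Qed.

Theorem proposition3p2p4 (K : cosmos) (A B : K) (f : A ~> B)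
    (T : cotensor (Delta 1) B) (C : comma T f)
    (t : A ~> C) (t1 : kcomp (comma1 C) t = idf A) (t0 : kcomp (comma0 C) t = f)
    (tphi : htpy (pre t (comma_cell C)) (const 1 f))
    (E : module A B) :
  qcat_equiv (precomp_over (mod_isofib E) (comma_fibE t1 t0)).
Proof.
set q := mod_fib E; set hq := mod_isofib E.
have gE := @mod_groupoidal _ _ _ E.
pose qA := kcomp (kfst A B) q; pose qB := kcomp (ksnd A B) q.
have hqA : isofib qA := isofib_comp (isofib_fst A B) hq.
pose D := comma_mod E T.
have [r [chi [[chi_src chi_tgt] qr chi_cell univ]]] := cartesian_lift E T.
have overA X n (s : X ~> kprod A B) (y : hom X E n) :
    post q y = const n s -> post qA y = const n (kcomp (kfst A B) s).
  by move=> h; rewrite -post_post h post_const.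
have overB X n (s : X ~> kprod A B) (y : hom X E n) :
    post q y = const n s -> post qB y = const n (kcomp (ksnd A B) s).
  by move=> h; rewrite -post_post h post_const.
pose p1 := comma1 C; pose p0 := comma0 C; pose phi := comma_cell C.
(* The inverse transports [y p1] along [phi]. *)
have sq n (y : map_over (kpair (idf A) f) hq n) :
    post qB (pre p1 (sval y)) = post (ev T ord_max) (const n (pb2 C)).
  rewrite post_pre (overB _ _ _ _ (svalP y)) snd_pair pre_const post_const.
  by rewrite comma_ev1.
pose lift n y := pb_ind D (sq n y).
have lift1 n y : post (pb1 D) (lift n y) = pre p1 (sval y) by apply: pb_ind1.
have lift2 n y : post (pb2 D) (lift n y) = const n (pb2 C) by apply: pb_ind2.
have inv_over n y : post q (post r (lift n y)) = const n (comma_fib C).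
  rewrite post_post qr; apply: prodn_uniq; rewrite post_post ?fst_pair ?snd_pair.
    rewrite -post_post lift1 post_pre (overA _ _ _ _ (svalP y)) fst_pair.
    by rewrite pre_const kcomp_id0l post_const.
  by rewrite -post_post lift2 !post_const comma_ev0.
pose inv n y : map_over (comma_fib C) hq n := exist _ _ (inv_over n y).
have inv_nat m n (a : dmap m n) y : inv m (act a y) = act a (inv n y).
  apply: sval_inj; change (post r (lift m (act a y)) = act a (post r (lift n y))).
  rewrite -[RHS]post_act; congr post.
  apply: (@pb_uniq _ _ _ _ _ _ D); rewrite post_act ?lift1 ?lift2.
    by rewrite -pre_act.
  by rewrite act_const.
exists (SMap inv_nat).
(* The first comparison [w0 => r (w1, qB om)], for the generic arrow [om] of [E]
   over an identity of [A]. *)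
have [F] := fibre_arrows_exist hqA.
pose om := fa_cell F; pose w0 := fa_src F; pose w1 : F ~> E := tgt om.
have om_qA : post qA om = const 1 (kcomp qA w0) := fa_over F.
have w0E : src om = w0 := fa_srcE F.
pose tau : F ~> T := ct_arr T (simplex_map (post qB om)).
have tauE k (u : Delta 1 k) : kcomp (ct_cone T k u) (const k tau) = act u (post qB om).
  by rewrite /tau ct_arrE.
have ksq : post qB w1 = post (ev T ord_max) tau.
  rewrite !post0 -[tau]const0 /ev tauE -tgt_post -[LHS]const0 const_tgt //.
pose k : F ~> D := pb_ind D ksq.
have k1 : kcomp (pb1 D) k = w1 by rewrite -post0; apply: pb_ind1.
have k2 : kcomp (pb2 D) k = tau by rewrite -post0; apply: pb_ind2.
have om_cell : post q om = pre k (comma_mod_cell E T).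
  apply: prodn_uniq; rewrite post_post post_pre ?post_fst_pairn ?post_snd_pairn.
    rewrite pre_const -[kcomp (kcomp _ (pb1 _)) k]kcomp_assoc [kcomp (pb1 _) k]k1
      -[kcomp (kcomp _ q) w1]tgt_post.
    by rewrite om_qA tgt_const.
  by rewrite pre_pre [kcomp (pb2 _) k]k2 /pre tauE act_id.
have [g [[g_src g_tgt] g_over]] : exists g : hom F E 1,
    arr w0 (kcomp r k) g /\ htpy (post q g) (const 1 (kcomp q w0)).
  apply: univ om_cell; last by split; rewrite ?k1.
  by apply: isofib_comp => //; apply: fa_isofib.
(* [sig e] classifies the arrow [e eta]; restricted along it, the comparison goes
   from [e] to [r (e t p1, phi)]. *)
have [eta [eta_src eta_tgt eta1 eta0]] := comma_unit t1 t0 tphi.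
pose M := map_over (comma_fib C) hq.
have G_nat n (e : M n) l m (a : dmap l m) (ub : sprod (Delta 1) (Delta n) m) :
    kcomp (act (act a ub).2 (sval e)) (act (act a ub).1 eta)
    = act a (kcomp (act ub.2 (sval e)) (act ub.1 eta)).
  by rewrite -kcomp_act !act_comp.
have G_over n (e : M n) m (u : Delta 1 m) (a : Delta n m) :
    post qA (SMap (G_nat n e) m (u, a)) = act a (const n p1).
  rewrite /= post_kcomp post_act (overA _ _ _ _ (svalP e)) !act_const.
  by rewrite -/(post _ (act u eta)) post_act eta1 act_const.
pose sig n e := projT1 (cid (fa_ind F (G_over n e))).
have sigE n e m (u : Delta 1 m) (a : Delta n m) :
    kcomp (act u om) (act a (sig n e)) = kcomp (act a (sval e)) (act u eta).
  exact: (projT2 (cid (fa_ind F (G_over n e)))).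
have sig_nat m n (a : dmap m n) e : sig m (act a e) = act a (sig n e).
  by apply: (@fa_uniq _ _ _ _ F) => l u b; rewrite sigE act_comp sigE /= act_comp.
have sig0 n e : post w0 (sig n e) = sval e.
  rewrite /post -w0E const_src -[sig n e]act_id sigE act_id -const_src eta_src.
  exact: kcomp_idr.
have sig1 n e : post w1 (sig n e) = pre (kcomp t p1) (sval e).
  by rewrite /post const_tgt -[sig n e]act_id sigE act_id -const_tgt eta_tgt.
have sig_over n e : post (kcomp q w0) (sig n e) = const n (comma_fib C).
  by rewrite -post_post sig0; apply: (svalP e).
have [a ha] := @fibre_homotopy K _ E q hq gE F C _ _ M (SMap sig_nat) g g_over sig_over.
(* The second comparison, for the generic element [u] of [E] over [(id, f)]; the
   section [sec y] of [U] specialises [u] to [y]. *)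
pose U := cosmos_pullback (kpair (idf A) f) hq.
pose u : U ~> E := pb2 U; pose pi : U ~> A := pb1 U.
have qu : kcomp q u = kcomp (kpair (idf A) f) pi by apply/esym/(pb_sq U).
have jsq : post qB u = post (ev T ord_max) (kcomp (pb2 C) (kcomp t pi)).
  rewrite !post0 /qB -kcomp_assoc qu !kcomp_assoc snd_pair comma_ev1.
  by rewrite -[kcomp (kcomp f _) t]kcomp_assoc t1 kcomp_id0r.
pose j : U ~> D := pb_ind D jsq.
have j1 : kcomp (pb1 D) j = u by rewrite -post0; apply: pb_ind1.
have j2 : kcomp (pb2 D) j = kcomp (pb2 C) (kcomp t pi) by rewrite -post0; apply: pb_ind2.
have chi_over : htpy (post q (pre j chi)) (const 1 (kcomp q u)).
  rewrite post_pre;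
  apply: (htpy_trans (@qcat_inner_kan _) (htpy_map (pre_map _ j) chi_cell)).
  apply: htpy_pairn; rewrite post_pre ?post_fst_pairn ?post_snd_pairn post_const kcomp_assoc.
    rewrite pre_const -[kcomp (kcomp _ (pb1 _)) j]kcomp_assoc [kcomp (pb1 _) j]j1.
    exact: htpy_refl.
  rewrite pre_pre [kcomp (pb2 _) j]j2 -pre_pre -/(comma_cell C) -pre_pre.
  have := htpy_map (pre_map B pi) tphi; rewrite /= pre_const.
  by rewrite -[kcomp (kcomp _ q) u]kcomp_assoc qu kcomp_assoc snd_pair.
pose N := map_over (kpair (idf A) f) hq.
have usq n (y : N n) : post (kpair (idf A) f) (const n (idf A)) = post q (sval y).
  by rewrite post_const kcomp_id0r; apply/esym/(svalP y).
pose sec n y : hom A U n := pb_ind U (usq n y).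
have sec1 n y : post pi (sec n y) = const n (idf A) by apply: pb_ind1.
have sec2 n y : post u (sec n y) = sval y by apply: pb_ind2.
have sec_nat m n (b : dmap m n) y : sec m (act b y) = act b (sec n y).
  apply: (@pb_uniq _ _ _ _ _ _ U); rewrite post_act ?sec1 ?sec2 //.
  by rewrite act_const.
have sec_over n y : post (kcomp q u) (sec n y) = const n (kpair (idf A) f).
  by rewrite -post_post sec2; apply: (svalP y).
have [b hb] := @fibre_homotopy K _ E q hq gE U A _ _ N (SMap sec_nat) _ chi_over sec_over.
exists a, b; split=> n x; apply: sval_inj.
- by rewrite (ha n x).1 g_src sig0.
- rewrite (ha n x).2 g_tgt -post_post /=; congr post.
  apply: (@pb_uniq _ _ _ _ _ _ D); rewrite post_post ?lift1 ?lift2.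
    by rewrite k1 sig1 /= pre_pre.
  rewrite k2; apply: ct_uniq => l v c.
  rewrite -post_act {1}/post kcomp_assoc tauE -post_act -post_kcomp sigE post_kcomp.
  rewrite post_act (overB _ _ _ _ (svalP x)) !act_const kcomp_ct_cone.
  by rewrite -/(post _ (act v eta)) post_act eta0.
- rewrite (hb n x).1 src_pre chi_src -post_post /= -post_pre; congr post.
  apply: (@pb_uniq _ _ _ _ _ _ D); rewrite post_post post_pre ?lift1 ?lift2.
    by rewrite j1 sec2 pre_pre t1 /pre kcomp_idr.
  by rewrite j2 kcomp_assoc -post_post sec1 pre_const post_const kcomp_id0r.
- by rewrite (hb n x).2 tgt_pre chi_tgt j1 sec2.
Qed.
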